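(* Let $U$ be an open connected subset of $\mathbb{R}$, and let $f:U\to\mathbb{R}$ be a smooth function without any flat point, i.e., for every $u\in U$ there exists $m=m(u)\in\mathbb{Z}^{>0}$ such that $f^{(m)}(u)\neq0$. Then the Fermat extension ${}^{\bullet}f:{}^{\bullet}U\to{}^{\bullet}\mathbb{R}$ has the intermediate value property.
   Context: Fermat reals: for $U\subseteq\mathbb{R}$ open, a little-oh polynomial on $U$ is a function $x:[0,\epsilon)\to U$ ($\epsilon>0$ depending on $x$) such that $x(t)=r+\sum_{i=1}^k\alpha_i t^{a_i}+o(t)$ as $t\to0^+$ for some $k\in\mathbb{N}$, $\alpha_i\in\mathbb{R}$, $a_i>0$, with $r=x(0)\in U$. Two such $x,y$ are equivalent if $x(0)=y(0)$ and $x(t)-y(t)=o(t)$; the quotient set is ${}^{\bullet}U$. Every $x\in{}^{\bullet}U$ is uniquely of the form $x={}^{\circ}x+\sum_{i=1}^l\beta_i t^{b_i}$ with ${}^{\circ}x\in U$ (standard part), $\beta_i\in\mathbb{R}\setminus\{0\}$, $0<b_1<\cdots<b_l\le1$; allowing $\beta_i=0$ gives a quasi-decomposition. ${}^{\bullet}\mathbb{R}$ is a commutative unital ring under pointwise operations, and ${}^{\bullet}U=\{x\in{}^{\bullet}\mathbb{R}:{}^{\circ}x\in U\}$. It is totally ordered: writing $x={}^{\circ}x+\sum_{i=1}^n\alpha_it^{a_i}$, $y={}^{\circ}y+\sum_{i=1}^n\beta_it^{a_i}$ with common exponents $0<a_1<\cdots<a_n\le1$, $x\le y$ iff $({}^{\circ}x,\alpha_1,\ldots,\alpha_n)\le({}^{\circ}y,\beta_1,\ldots,\beta_n)$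 lexicographically. For smooth $f:U\to\mathbb{R}$ the Fermat extension is ${}^{\bullet}f:{}^{\bullet}U\to{}^{\bullet}\mathbb{R}$, ${}^{\bullet}f([x])=[f\circ x]$. A function $g:{}^{\bullet}U\to{}^{\bullet}\mathbb{R}$ ($U\subseteq\mathbb{R}$ open connected) has the intermediate value property if for all $a,b\in{}^{\bullet}U$ with $a<b$ and every $y\in{}^{\bullet}\mathbb{R}$ between $g(a)$ and $g(b)$, there is $c\in{}^{\bullet}\mathbb{R}$ between $a$ and $b$ with $g(c)=y$. *)

(* Defs.v *)
From HB Require Import structures.
From mathcomp Require Import all_boot all_order all_algebra.
From mathcomp Require Import generic_quotient.
From mathcomp Require Import all_classical all_reals all_analysis.
From mathcomp Require Import ring lra.
Set Implicit Arguments.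
Unset Strict Implicit.
Unset Printing Implicit Defensive.
Import Order.TTheory GRing.Theory Num.Theory.
Import numFieldNormedType.Exports.
Local Open Scope classical_set_scope.
Local Open Scope ring_scope.
Local Open Scope quotient_scope.

Section LittleOhPolynomials.
Context {R : realType}.
Implicit Types (U : set R) (x y f : R -> R).

Definition small_oh x : Prop := x =o_ ((0 : R)^'+) id.

(* For a_i > 0 the sum vanishes at t = 0, since 0 `^ a = 0 for a != 0. *)
Definition power_sum k (alpha a : k.-tuple R) : R -> R :=
  fun t => \sum_(i < k) tnth alpha i * t `^ tnth a i.

(* A function [0, eps) -> U is represented by any extension of it to a total
   function R -> R; the equivalence below only sees the values near 0+ and at
   0, so the choice of extension is immaterial. *)
Definition little_oh_poly U x : Prop :=
  (exists2 eps : R, 0 < eps & forall t, 0 <= t < eps -> U (x t)) /\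
  exists k (alpha a : k.-tuple R),
    (forall i, 0 < tnth a i) /\
    small_oh (fun t => x t - (x 0 + power_sum alpha a t)).

Definition lo_equiv x y : Prop := x 0 = y 0 /\ small_oh (x \- y).

(* f : U -> R, with U open, is represented by any extension to R; only the
   values of f on U matter for the derivatives at points of U. *)
Definition smooth_on U f : Prop :=
  forall n u, U u -> derivable (f^`(n))%classic u 1.

Lemma small_ohP x : small_oh x <->
  forall e : R, 0 < e -> \forall t \near 0^'+, `|x t| <= e * t.
Proof.
have t0 : \forall t \near (0 : R)^'+, 0 < t by exact: nbhs_right_gt.
rewrite /small_oh; split=> [/eqoP xo e e0|xo].
  by have := xo e e0; move: t0; apply: filterS2 => t /= t0; rewrite (gtr0_norm t0).
apply/eqoP => e e0; have := xo e e0; move: t0; apply: filterS2 => t /= t0.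
by rewrite (gtr0_norm t0).
Qed.

Lemma small_ohD x y : small_oh x -> small_oh y -> small_oh (fun t => x t + y t).
Proof.
move=> /small_ohP xo /small_ohP yo; apply/small_ohP => e e0.
have e2 : 0 < e / 2 by rewrite divr_gt0.
near=> t; apply: (le_trans (ler_normD _ _)).
rewrite [e]splitr mulrDl lerD//; near: t; [exact: xo|exact: yo].
Unshelve. all: by end_near. Qed.

Lemma small_ohN x : small_oh x -> small_oh (fun t => - x t).
Proof.
move=> /small_ohP xo; apply/small_ohP => e /xo.
by apply: filterS => t; rewrite normrN.
Qed.

Lemma small_oh_near x y : (\forall t \near 0^'+, x t = y t) ->
  small_oh x -> small_oh y.
Proof.
move=> xy /small_ohP xo; apply/small_ohP => e e0.
by near=> t; rewrite -(near xy t)//; near: t; exact: xo.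
Unshelve. all: by end_near. Qed.

Lemma small_oh_ext x y : x =1 y -> small_oh x -> small_oh y.
Proof. by move=> /funext ->. Qed.

Lemma small_oh0 : small_oh (fun=> 0).
Proof.
apply/small_ohP => e e0; near=> t; rewrite normr0 mulr_ge0// ?ltW//.
Unshelve. all: by end_near. Qed.

Definition bounded_at0 x :=
  exists2 C : R, 0 < C & \forall t \near 0^'+, `|x t| <= C.

Lemma bounded_at0D x y : bounded_at0 x -> bounded_at0 y ->
  bounded_at0 (fun t => x t + y t).
Proof.
move=> [C C0 xC] [D D0 yD]; exists (C + D); first exact: addr_gt0.
near=> t; apply: (le_trans (ler_normD _ _)); rewrite lerD//; near: t => //.
Unshelve. all: by end_near. Qed.

Lemma bounded_at0M x y : bounded_at0 x -> bounded_at0 y ->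
  bounded_at0 (fun t => x t * y t).
Proof.
move=> [C C0 xC] [D D0 yD]; exists (C * D); first exact: mulr_gt0.
near=> t; rewrite normrM ler_pM//; near: t => //.
Unshelve. all: by end_near. Qed.

Lemma bounded_at0_cst c : bounded_at0 (fun=> c).
Proof.
exists (`|c| + 1); first by rewrite ltr_pwDr.
by apply: nearW => t; rewrite lerDl.
Qed.

Lemma small_oh_bounded x : small_oh x -> bounded_at0 x.
Proof.
move=> /small_ohP/(_ 1 ltr01) xo; exists 1 => //.
near=> t; have : `|x t| <= 1 * t by near: t.
move=> /le_trans; apply; rewrite mul1r ltW//; near: t; exact: nbhs_right_lt.
Unshelve. all: by end_near. Qed.

Lemma small_ohM x y : bounded_at0 x -> small_oh y ->
  small_oh (fun t => x t * y t).
Proof.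
move=> [C C0 xC] /small_ohP yo; apply/small_ohP => e e0.
have eC : 0 < e / C by rewrite divr_gt0.
near=> t; rewrite normrM.
have -> : e * t = C * (e / C * t) by field; rewrite gt_eqF.
by rewrite ler_pM//; near: t => //; exact: yo.
Unshelve. all: by end_near. Qed.

Definition psum (s : seq (R * R)) (t : R) := \sum_(p <- s) p.1 * t `^ p.2.
Definition exps_gt0 (s : seq (R * R)) := all (fun p => 0 < p.2) s.

Lemma power_sumE k (alpha a : k.-tuple R) : power_sum alpha a = psum (zip alpha a).
Proof.
apply/funext => t; rewrite /power_sum /psum (big_nth (0, 0)) big_mkord.
rewrite size_zip !size_tuple minnn; apply: eq_bigr => i _.
by rewrite nth_zip ?size_tuple//= !(tnth_nth 0).
Qed.

Lemma psumE s :
  psum s = power_sum (map_tuple fst (in_tuple s)) (map_tuple snd (in_tuple s)).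
Proof. by rewrite power_sumE /= zip_unzip. Qed.

(* Unlike in [little_oh_poly], c is not required to be x(0). *)
Definition expansion x c :=
  exists2 s, exps_gt0 s & small_oh (fun t => x t - (c + psum s t)).

Lemma psum_cons p s t : psum (p :: s) t = p.1 * t `^ p.2 + psum s t.
Proof. by rewrite /psum big_cons. Qed.

Lemma psum_cat s1 s2 t : psum (s1 ++ s2) t = psum s1 t + psum s2 t.
Proof. by rewrite /psum big_cat. Qed.

Lemma psum_scale c s t : psum [seq (c * p.1, p.2) | p <- s] t = c * psum s t.
Proof.
by rewrite /psum big_map mulr_sumr; apply: eq_bigr => p _; rewrite mulrA.
Qed.

Lemma psum_mul s1 s2 t : 0 < t ->
  psum [seq (p.1 * q.1, p.2 + q.2) | p <- s1, q <- s2] t = psum s1 t * psum s2 t.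
Proof.
move=> t0; rewrite /psum big_allpairs_dep mulr_suml; apply: eq_bigr => p _.
rewrite mulr_sumr; apply: eq_bigr => q _ /=.
rewrite powRD; last by apply/implyP => _; rewrite gt_eqF.
ring.
Qed.

Lemma psum_pow s : exps_gt0 s -> exists a C : R, [/\ 0 < a <= 1, 0 < C &
  \forall t \near 0^'+, `|psum s t| <= C * t `^ a].
Proof.
elim: s => [_|p s IH /=/andP[p0 /IH[a [C [/andP[a0 a1] C0 H]]]]].
  exists 1, 1; split => //; first by rewrite ltr01 lexx.
  by near=> t; rewrite /psum big_nil normr0 mul1r powR_ge0.
pose b := Num.min a p.2.
have b0 : 0 < b by rewrite lt_min a0 p0.
exists b, (`|p.1| + C); split; [by rewrite b0 ge_min a1|by rewrite ltr_wpDl|].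
near=> t.
have t01 : 0 < t <= 1.
  by apply/andP; split; [|apply: ltW]; near: t; [exact: nbhs_right_gt|exact: nbhs_right_lt].
rewrite psum_cons; apply: (le_trans (ler_normD _ _)); rewrite mulrDl lerD//.
  rewrite normrM ler_wpM2l// ger0_norm ?powR_ge0//.
  by apply: ger_powR => //; rewrite ge_min lexx orbT.
have : `|psum s t| <= C * t `^ a by near: t.
move=> /le_trans; apply; rewrite ler_pM2l//.
by apply: ger_powR => //; rewrite ge_min lexx.
Unshelve. all: by end_near. Qed.

Lemma expansion_pow x c : expansion x c -> exists a C : R, [/\ 0 < a, 0 < C &
  \forall t \near 0^'+, `|x t - c| <= C * t `^ a].
Proof.
move=> [s /psum_pow[a [C [/andP[a0 a1] C0 H]]] /small_ohP/(_ 1 ltr01) xs].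
exists a, (C + 1); split => //; first by rewrite addr_gt0.
near=> t.
have t01 : 0 < t <= 1.
  by apply/andP; split; [|apply: ltW]; near: t; [exact: nbhs_right_gt|exact: nbhs_right_lt].
have -> : x t - c = psum s t + (x t - (c + psum s t)) by ring.
apply: (le_trans (ler_normD _ _)); rewrite mulrDl lerD//; first by near: t.
have : `|x t - (c + psum s t)| <= 1 * t by near: t.
by move=> /le_trans; apply; rewrite !mul1r; apply: ger1_powR.
Unshelve. all: by end_near. Qed.

Lemma expansion_cvg x c : expansion x c -> x t @[t --> 0^'+] --> c.
Proof.
move=> /expansion_pow[a [C [a0 C0 H]]].
apply/cvgrPdist_le => e e0.
have /cvgr0_norm_le/(_ (e / C)) := powR_cvg0 a0.
rewrite divr_gt0// => /(_ isT) P.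
near=> t; rewrite distrC.
have : `|x t - c| <= C * t `^ a by near: t.
move=> /le_trans; apply; rewrite mulrC -ler_pdivlMr//.
by apply: le_trans (ler_norm _) _; near: t.
Unshelve. all: by end_near. Qed.

Lemma expansion_bounded x c : expansion x c -> bounded_at0 x.
Proof.
move=> /expansion_cvg/cvgr_dist_le/(_ 1 ltr01) xc.
exists (1 + `|c|); first by rewrite ltr_pwDl.
near=> t; have -> : x t = (x t - c) + c by ring.
apply: (le_trans (ler_normD _ _)); rewrite lerD// distrC.
by near: t.
Unshelve. all: by end_near. Qed.

Lemma expansion_small x y c : small_oh (x \- y) -> expansion y c -> expansion x c.
Proof.
move=> xy [s s0 ys]; exists s => //.
by apply: small_oh_ext (small_ohD xy ys) => t /=; ring.
Qed.

Lemma psum_expansion s c : exps_gt0 s -> expansion (fun t => c + psum s t) c.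
Proof.
by move=> s0; exists s => //; apply: small_oh_ext small_oh0 => t; rewrite subrr.
Qed.

Lemma expansion_cst c : expansion (fun=> c) c.
Proof.
exists [::] => //; apply: small_oh_ext small_oh0 => t.
by rewrite /psum big_nil; ring.
Qed.

Lemma expansionD x y c d : expansion x c -> expansion y d ->
  expansion (fun t => x t + y t) (c + d).
Proof.
move=> [s s0 xs] [s' s'0 ys]; exists (s ++ s').
  by rewrite /exps_gt0 all_cat; apply/andP.
apply: small_oh_ext (small_ohD xs ys) => t /=; rewrite psum_cat; ring.
Qed.

Lemma expansionM x y c d : expansion x c -> expansion y d ->
  expansion (fun t => x t * y t) (c * d).
Proof.
move=> Ex Ey; have By := expansion_bounded Ey.
case: Ex Ey => s s0 xs [s' s'0 ys].
have Bs := expansion_bounded (psum_expansion c s0).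
exists ([seq (c * p.1, p.2) | p <- s'] ++ [seq (d * p.1, p.2) | p <- s] ++
   [seq (p.1 * q.1, p.2 + q.2) | p <- s, q <- s']).
  rewrite /exps_gt0 !all_cat !all_map; apply/and3P; split => //.
  apply/allP => _ /allpairsP[[p q] [/= ps qs' ->]] /=.
  by apply: addr_gt0; [exact: (allP s0 _ ps)|exact: (allP s'0 _ qs')].
apply: small_oh_near (small_ohD (small_ohM By xs) (small_ohM Bs ys)).
near=> t; rewrite !psum_cat !psum_scale psum_mul//; ring.
Unshelve. all: by end_near. Qed.

Lemma expansion_horner (Q : {poly R}) x c : expansion x c ->
  expansion (fun t => Q.[x t]) Q.[c].
Proof.
move=> xc; elim/poly_ind: Q => [|Q a IH].
  by under eq_fun do rewrite horner0; rewrite horner0; exact: expansion_cst.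
under eq_fun do rewrite hornerMXaddC; rewrite hornerMXaddC.
by apply: expansionD (expansion_cst _); exact: expansionM.
Qed.

Lemma small_oh_horner (Q : {poly R}) x y c d : expansion x c -> expansion y d ->
  small_oh (fun t => x t - y t) -> small_oh (fun t => Q.[x t] - Q.[y t]).
Proof.
move=> xc yd xy; elim/poly_ind: Q => [|Q a IH].
  by apply: small_oh_ext small_oh0 => t; rewrite !horner0 subr0.
have Bx := expansion_bounded xc.
have BQ := expansion_bounded (expansion_horner Q yd).
apply: small_oh_ext (small_ohD (small_ohM Bx IH) (small_ohM BQ xy)) => t.
rewrite !hornerMXaddC; ring.
Qed.

Lemma antideriv (Q : {poly R}) : exists P : {poly R}, P^`() = Q /\ P.[0] = 0.
Proof.
exists (\poly_(i < (size Q).+1) (Q`_i.-1 / i%:R)); split; last first.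
  by rewrite horner_coef0 coef_poly /= invr0 mulr0.
apply/polyP => i; rewrite coef_deriv coef_poly ltnS.
case: ltnP => iQ; last by rewrite mul0rn nth_default.
by rewrite -[LHS]mulr_natr divfK// pnatr_eq0.
Qed.

Lemma smooth_on_derive1 U f : smooth_on U f -> smooth_on U (f^`())%classic.
Proof. by move=> fU n u Uu; rewrite -derive1Sn; exact: fU. Qed.

Lemma smooth_approx n U f r : open U -> smooth_on U f -> U r ->
  exists (Q : {poly R}) (C d : R), [/\ 0 < C, 0 < d &
    forall s, `|s - r| < d -> `|f s - Q.[s - r]| <= C * `|s - r| ^+ n].
Proof.
move=> oU + Ur; elim: n f => [|n IH] f fU.
  have fc : f @ r --> f r.
    by apply/differentiable_continuous/derivable1_diffP; exact: (fU 0%N).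
  move: fc => /cvgr_dist_le/(_ 1 ltr01)/nbhs_ballP[d /= d0 dP].
  exists (f r)%:P, 1, d; split => // s sr.
  rewrite hornerC expr0 mulr1 distrC; apply: dP.
  by rewrite -ball_normE /= distrC.
have [Q [C [d [C0 d0 H]]]] := IH _ (smooth_on_derive1 fU).
have /nbhs_ballP[e /= e0 eU] : nbhs r U by exact: open_nbhs_nbhs.
have [P [PQ P0]] := antideriv Q.
exists (P + (f r)%:P), C, (Num.min d e); split => //.
  by rewrite lt_min d0 e0.
move=> s; rewrite lt_min => /andP[sd se].
pose P1 := P \Po ('X - r%:P).
have P1E z : P1.[z] = P.[z - r] by rewrite horner_comp !hornerE.
pose g z := f z - P1.[z].
have gder z : `|z - r| < e -> is_derive z 1 g ((f^`())%classic z - Q.[z - r]).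
  move=> ze.
  have -> : Q.[z - r] = P1^`().[z].
    by rewrite deriv_comp PQ derivXsubC mulr1 horner_comp !hornerE.
  apply: (@is_deriveB _ _ _ f (horner P1)).
  rewrite derive1E; apply: derivableP; apply: (fU 0%N).
  by apply: eU; rewrite -ball_normE /= distrC.
have gdrv z : `|z - r| < e -> derivable g z 1 by move=> /gder[].
have gr : g r = f r by rewrite /g P1E subrr P0 subr0.
have -> : f s - (P + (f r)%:P).[s - r] = g s - g r.
  by rewrite gr /g P1E hornerD hornerC; ring.
suff [c cs ->] : exists2 c, `|c - r| <= `|s - r| &
    `|g s - g r| = `|(f^`())%classic c - Q.[c - r]| * `|s - r|.
  rewrite exprSr mulrA ler_wpM2r//.
  apply: (le_trans (H _ (le_lt_trans cs sd))).
  by rewrite ler_pM2l// lerXn2r// nnegrE.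
have [rs|sr] := leP r s.
  have sub z : z \in `[r, s] -> `|z - r| <= `|s - r|.
    by rewrite in_itv /= => /andP[rz zs]; rewrite !ger0_norm ?subr_ge0// lerD2r.
  have [||c /sub cs gE] := @MVT_segment R g
      (fun z => (f^`())%classic z - Q.[z - r]) r s rs.
  - move=> z /subset_itv_oo_cc /sub zs; exact: gder (le_lt_trans zs se).
  - apply: derivable_within_continuous => z /sub zs.
    exact: gdrv (le_lt_trans zs se).
  by exists c => //; rewrite gE normrM.
have sub z : z \in `[s, r] -> `|z - r| <= `|s - r|.
  rewrite in_itv /= => /andP[rz zs].
  by rewrite !(distrC _ r) !ger0_norm ?subr_ge0 ?(ltW sr)// lerD2l lerN2.
have [||c /sub cs gE] := @MVT_segment R g
    (fun z => (f^`())%classic z - Q.[z - r]) s r (ltW sr).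
- move=> z /subset_itv_oo_cc /sub zs; exact: gder (le_lt_trans zs se).
- apply: derivable_within_continuous => z /sub zs.
  exact: gdrv (le_lt_trans zs se).
by exists c => //; rewrite distrC gE normrM (distrC r).
Qed.

Lemma little_oh_poly_expansion U x : little_oh_poly U x -> expansion x (x 0).
Proof.
move=> [_ [k [alpha [a [a0 xo]]]]]; exists (zip alpha a); last first.
  by rewrite -power_sumE.
apply/(all_nthP (0, 0)) => i; rewrite size_zip !size_tuple minnn => ik.
by rewrite nth_zip ?size_tuple//= -(tnth_nth 0 a (Ordinal ik)).
Qed.

Lemma expansion_little_oh_poly U x :
  (exists2 eps : R, 0 < eps & forall t, 0 <= t < eps -> U (x t)) ->
  expansion x (x 0) -> little_oh_poly U x.
Proof.
move=> xU [s s0 xo]; split => //; exists (size s).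
exists (map_tuple fst (in_tuple s)), (map_tuple snd (in_tuple s)); split.
  move=> i; rewrite tnth_map (tnth_nth (0, 0)) /=.
  by apply: (all_nthP _ s0); exact: ltn_ord.
by rewrite -psumE.
Qed.

Lemma little_oh_poly0 U x : little_oh_poly U x -> U (x 0).
Proof. by move=> [[e e0 xU] _]; apply: xU; rewrite lexx e0. Qed.

Lemma approx_small_oh f (Q : {poly R}) (r D d a C : R) n y :
  0 < D -> 0 < d ->
  (forall s, `|s - r| < d -> `|f s - Q.[s - r]| <= D * `|s - r| ^+ n) ->
  expansion y r -> 0 < C -> 2 <= a * n%:R ->
  (\forall t \near 0^'+, `|y t - r| <= C * t `^ a) ->
  small_oh (fun t => f (y t) - Q.[y t - r]).
Proof.
move=> D0 d0 H yE C0 an yC; apply/small_ohP => e e0.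
have K0 : 0 < D * C ^+ n by rewrite mulr_gt0// exprn_gt0.
have eK : 0 < e / (D * C ^+ n) by rewrite divr_gt0.
have /cvgr_dist_lt/(_ d d0) yd := expansion_cvg yE.
near=> t.
have t0 : 0 < t by near: t; exact: nbhs_right_gt.
have t1 : t <= 1 by apply: ltW; near: t; exact: nbhs_right_lt.
have te : t <= e / (D * C ^+ n) by apply: ltW; near: t; exact: nbhs_right_lt.
have : `|y t - r| <= C * t `^ a by near: t.
have : `|r - y t| < d by near: t.
rewrite distrC => /H fQ ytC; apply: (le_trans fQ).
apply: (@le_trans _ _ (D * (C * t `^ a) ^+ n)).
  by rewrite ler_pM2l// lerXn2r// nnegrE mulr_ge0 ?powR_ge0// ltW.
rewrite exprMn -(powR_mulrn n (powR_ge0 _ _)) -powRrM mulrA.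
apply: (@le_trans _ _ (D * C ^+ n * t `^ 2)).
  by rewrite ler_pM2l//; apply: ger_powR => //; rewrite t0.
rewrite (powR_mulrn 2)// ?(ltW t0)// expr2 mulrA ler_pM2r//.
by rewrite mulrC -ler_pdivlMr.
Unshelve. all: by end_near. Qed.

Lemma smooth_along U f x y : open U -> smooth_on U f -> U (x 0) ->
  expansion x (x 0) -> expansion y (x 0) -> exists Q : {poly R},
    small_oh (fun t => f (x t) - Q.[x t - x 0]) /\
    small_oh (fun t => f (y t) - Q.[y t - x 0]).
Proof.
move=> oU fU xU xE yE.
have [a [C [a0 C0 xC]]] := expansion_pow xE.
have [b [B [b0 B0 yB]]] := expansion_pow yE.
pose c := Num.min a b; have c0 : 0 < c by rewrite lt_min a0.
have [n nc] : exists n, 2 <= c * n%:R.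
  exists (Num.bound (2 / c)); rewrite mulrC -ler_pdivrMr//.
  by apply/ltW/archi_boundP; rewrite divr_ge0// ltW.
have [Q [D [d [D0 d0 H]]]] := smooth_approx n oU fU xU.
exists Q; split.
- apply: (approx_small_oh D0 d0 H xE C0 _ xC); apply: (le_trans nc).
  by rewrite ler_wpM2r// ge_min lexx.
- apply: (approx_small_oh D0 d0 H yE B0 _ yB); apply: (le_trans nc).
  by rewrite ler_wpM2r// ge_min lexx orbT.
Qed.

Lemma expansion_shift x c r : expansion x c -> expansion (fun t => x t - r) (c - r).
Proof. by move=> xc; exact: expansionD xc (expansion_cst _). Qed.

Lemma lo_equiv_comp U f x y : open U -> smooth_on U f ->
  little_oh_poly U x -> little_oh_poly U y -> lo_equiv x y ->
  lo_equiv (f \o x) (f \o y).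
Proof.
move=> oU fU xP yP [x0 xy]; split; first by rewrite /= x0.
have xE := little_oh_poly_expansion xP.
have yE : expansion y (x 0) by rewrite x0; exact: little_oh_poly_expansion yP.
have [Q [xQ yQ]] := smooth_along oU fU (little_oh_poly0 xP) xE yE.
have xyr : small_oh (fun t => (x t - x 0) - (y t - x 0)).
  by apply: small_oh_ext xy => t /=; ring.
have QQ := small_oh_horner Q (expansion_shift (x 0) xE)
  (expansion_shift (x 0) yE) xyr.
by apply: small_oh_ext (small_ohD (small_ohD xQ QQ) (small_ohN yQ)) => t /=; ring.
Qed.

Lemma little_oh_poly_comp U f x : open U -> smooth_on U f ->
  little_oh_poly U x -> little_oh_poly setT (f \o x).
Proof.
move=> oU fU xP; have xE := little_oh_poly_expansion xP.
have [Q [xQ _]] := smooth_along oU fU (little_oh_poly0 xP) xE xE.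
apply: expansion_little_oh_poly; first by exists 1.
have fxE : expansion (f \o x) Q.[x 0 - x 0].
  exact: expansion_small xQ (expansion_horner Q (expansion_shift _ xE)).
suff -> : (f \o x) 0 = Q.[x 0 - x 0] by [].
have fc : f @ x 0 --> f (x 0).
  apply/differentiable_continuous/derivable1_diffP.
  exact: (fU 0%N _ (little_oh_poly0 xP)).
apply: (@cvg_unique _ _ ((f \o x) t @[t --> 0^'+])).
- exact: norm_hausdorff.
- exact: cvg_comp (expansion_cvg xE) fc.
- exact: expansion_cvg fxE.
Qed.

Lemma little_oh_poly_setT U x : little_oh_poly U x -> little_oh_poly setT x.
Proof. by move=> [_ xE]; split => //; exists 1. Qed.

Lemma lo_equiv_refl x : lo_equiv x x.
Proof. by split => //; apply: small_oh_ext small_oh0 => t /=; rewrite subrr. Qed.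

Lemma lo_equiv_sym x y : lo_equiv x y -> lo_equiv y x.
Proof.
by move=> [xy0 /small_ohN xy]; split => //; apply: small_oh_ext xy => t /=; ring.
Qed.

Lemma lo_equiv_trans y x z : lo_equiv x y -> lo_equiv y z -> lo_equiv x z.
Proof.
move=> [xy0 xy] [yz0 yz]; split; first by rewrite xy0.
by apply: small_oh_ext (small_ohD xy yz) => t /=; ring.
Qed.

End LittleOhPolynomials.

Record lopoly (R : realType) (U : set R) := Lopoly {
  lopoly_fun :> R -> R;
  lopolyP : little_oh_poly U lopoly_fun }.

HB.instance Definition _ (R : realType) (U : set R) := gen_eqMixin (lopoly U).
HB.instance Definition _ (R : realType) (U : set R) := gen_choiceMixin (lopoly U).

Definition lopoly_rel (R : realType) (U : set R) : rel (lopoly U) :=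
  fun x y => `[< lo_equiv x y >].

Lemma lopoly_rel_is_equiv (R : realType) (U : set R) :
  equiv_class_of (@lopoly_rel R U).
Proof.
split=> [x|x y|y x z]; first exact/asboolP/lo_equiv_refl.
  by apply/asboolP/asboolP => /lo_equiv_sym.
by move=> /asboolP xy /asboolP yz; exact/asboolP/(lo_equiv_trans xy).
Qed.

Canonical lopoly_equiv (R : realType) (U : set R) :=
  EquivRelPack (@lopoly_rel_is_equiv R U).

(* The Fermat extension of U; the ring of Fermat reals is [fermat setT]. *)
Definition fermat (R : realType) (U : set R) : Type := {eq_quot @lopoly_rel R U}.

Section Fermat.
Context {R : realType}.
Implicit Types (U : set R) (f : R -> R).

Definition fclass U (x : lopoly U) : fermat U := \pi_{eq_quot @lopoly_rel R U} x.
Definition frepr U (x : fermat U) : lopoly U := repr (x : {eq_quot @lopoly_rel R U}).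

Lemma freprK U : cancel (@frepr U) (@fclass U).
Proof. by move=> x; exact: reprK. Qed.

Lemma fclassP U (x y : lopoly U) : fclass x = fclass y <-> lo_equiv x y.
Proof. by split=> [/eqquotP/asboolP//|xy]; exact/eqquotP/asboolP. Qed.

(* The extension of U is a quotient of its own and not literally a subset of
   the Fermat reals; [fincl] is the (injective) identification. *)
Definition fincl U (x : fermat U) : fermat (@setT R) :=
  fclass (Lopoly (little_oh_poly_setT (lopolyP (frepr x)))).

Lemma fincl_class U (x : lopoly U) :
  fincl (fclass x) = fclass (Lopoly (little_oh_poly_setT (lopolyP x))).
Proof. by apply/fclassP => /=; apply/fclassP; rewrite freprK. Qed.

Lemma fincl_inj U : injective (@fincl U).
Proof.
move=> x y /fclassP /= xy; rewrite -[x]freprK -[y]freprK; exact/fclassP.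
Qed.

(* Defined on a chosen representative; [fext_class] shows that the value on
   the class of any x is the class of f \o x. *)
Definition fext U f (oU : open U) (fU : smooth_on U f) (x : fermat U) :
    fermat (@setT R) :=
  fclass (Lopoly (little_oh_poly_comp oU fU (lopolyP (frepr x)))).

Lemma fext_class U f (oU : open U) (fU : smooth_on U f) (x : lopoly U) :
  fext oU fU (fclass x) = fclass (Lopoly (little_oh_poly_comp oU fU (lopolyP x))).
Proof.
apply/fclassP => /=; apply: (lo_equiv_comp oU fU); try exact: lopolyP.
by apply/fclassP; rewrite freprK.
Qed.

(* x is the class of t |-> r + \sum_i alpha_i t^(a_i), with zero coefficients
   alpha_i allowed *)
Definition quasi_decomposition (x : fermat (@setT R)) (r : R) n
    (alpha a : n.-tuple R) : Prop :=
  exists2 p : lopoly (@setT R), x = fclass p &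
    lopoly_fun p = (fun t => r + power_sum alpha a t).

(* Since zero coefficients are allowed, any two Fermat reals can be written with
   common exponents. *)
Definition fle (x y : fermat (@setT R)) : Prop :=
  exists n (a : n.-tuple R) (r s : R) (alpha beta : n.-tuple R),
    [/\ sorted <%R a /\ (forall i, 0 < tnth a i <= 1),
        quasi_decomposition x r alpha a,
        quasi_decomposition y s beta a &
        ((r :: alpha : seqlexi R) <= (s :: beta : seqlexi R))%O].

Definition flt (x y : fermat (@setT R)) : Prop := fle x y /\ x <> y.

(* z lies in the closed interval with endpoints x and y, in either order. *)
Definition fbetween (x y z : fermat (@setT R)) : Prop :=
  (fle x z /\ fle z y) \/ (fle y z /\ fle z x).

Definition intermediate_value_property U (g : fermat U -> fermat (@setT R)) :
    Prop :=
  forall a b : fermat U, flt (fincl a) (fincl b) ->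
  forall y, fbetween (g a) (g b) y ->
  exists c : fermat U,
    [/\ fle (fincl a) (fincl c), fle (fincl c) (fincl b) & g c = y].

End Fermat.

(* Main.v *)
(* The order on Fermat reals compares leading terms, so x <= y iff x ~ y or
   y(t) - x(t) >= k t eventually for some k > 0.  The statement is additive in
   the interval: if it holds on [a, b] and on [b, c], then on [a, c], because
   the order is total.  A Lebesgue-type supremum argument thus reduces it to
   infinitesimal neighbourhoods of a real point u, and splitting at u itself to
   the one-sided neighbourhoods, where f is strictly monotone since f' has no
   zero near u other than possibly u.  There a root c of f(c) = y is sought
   around the real solution c0 of f(c0) = y(0): if f - f(c0) vanishes to order m at c0 and
   y - f(c0) = t^e (K + ...), the substitution c = c0 + t^(e/m) x(t) turns the
   equation into one with a simple real root at t = 0, which Newton iteration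
   lifts to a little-oh polynomial solving it up to o(t).  Monotonicity then
   places c between the endpoints. *)

Require Import Defs.
From HB Require Import structures.
From mathcomp Require Import all_boot all_order all_algebra.
From mathcomp Require Import all_classical all_reals all_analysis.
From mathcomp Require Import ring lra.
Set Implicit Arguments.
Unset Strict Implicit.
Unset Printing Implicit Defensive.
Import Order.TTheory GRing.Theory Num.Theory.
Import numFieldNormedType.Exports.
Local Open Scope classical_set_scope.
Local Open Scope ring_scope.

(** * Leading terms and the strict order on representatives *)

Section AsymptoticOrder.
Context {R : realType}.
Implicit Types (x y z : R -> R) (s : seq (R * R)) (E : seq R).

(* A gap of order t rather than mere eventual inequality: this makes the
   relation invariant under o(t) perturbations, i.e. a relation on classes. *)
Definition slt x y : Prop :=
  exists2 k : R, 0 < k & \forall t \near 0^'+, k * t <= y t - x t.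

Lemma near0_ex (P : R -> Prop) : (\forall t \near 0^'+, P t) -> exists t, P t.
Proof. exact: (@filter_ex _ ((0 : R)^'+) _ P). Qed.

Lemma near0_le1 : \forall t \near (0 : R)^'+, 0 < t <= 1.
Proof.
near=> t; apply/andP; split; [|apply: ltW]; near: t.
  exact: nbhs_right_gt.
exact: nbhs_right_lt.
Unshelve. all: by end_near. Qed.

Lemma near_lt_asym x y : (\forall t \near 0^'+, x t < y t) ->
  (\forall t \near 0^'+, y t < x t) -> False.
Proof.
move=> xy yx.
have /near0_ex[t /andP[]] : \forall t \near 0^'+, (x t < y t) && (y t < x t).
  by near=> t; apply/andP; split; near: t.
by move=> a /(lt_trans a); rewrite ltxx.
Unshelve. all: by end_near. Qed.

Lemma slt_lt x y : slt x y -> \forall t \near 0^'+, x t < y t.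
Proof.
move=> [k k0 H]; near=> t; rewrite -subr_gt0; apply: (@lt_le_trans _ _ (k * t)).
  by rewrite mulr_gt0.
by near: t.
Unshelve. all: by end_near. Qed.

Lemma slt_asym x y : slt x y -> slt y x -> False.
Proof. by move=> /slt_lt xy /slt_lt; exact: near_lt_asym. Qed.

Lemma slt_trans y x z : slt x y -> slt y z -> slt x z.
Proof.
move=> [k k0 xy] [l l0 yz]; exists (k + l); first exact: addr_gt0.
near=> t.
have : k * t <= y t - x t by near: t.
have : l * t <= z t - y t by near: t.
lra.
Unshelve. all: by end_near. Qed.

Lemma slt_near x x' y y' : (\forall t \near 0^'+, y t - x t = y' t - x' t) ->
  slt x y -> slt x' y'.
Proof.
move=> e [k k0 H]; exists k => //; near=> t.
by rewrite -(near e t) //; near: t.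
Unshelve. all: by end_near. Qed.

Lemma slt_small_oh x x' y y' : small_oh (fun t => x t - x' t) ->
  small_oh (fun t => y t - y' t) -> slt x y -> slt x' y'.
Proof.
move=> /small_ohP xx' /small_ohP yy' [k k0 H].
have k4 : 0 < k / 4 by rewrite divr_gt0.
exists (k / 2); first by rewrite divr_gt0.
near=> t.
have : k * t <= y t - x t by near: t.
have : `|x t - x' t| <= k / 4 * t by near: t; exact: xx'.
have : `|y t - y' t| <= k / 4 * t by near: t; exact: yy'.
rewrite !ler_norml => /andP[? ?] /andP[? ?] ?; lra.
Unshelve. all: by end_near. Qed.

(** Eventually [K + psum s t] exceeds [K / 2], and [t <= t ^ e] on (0, 1] because [e <= 1]. The main
    part is thus at least [K / 2 * t], and the o(t) error costs at most half of that. *)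
Lemma slt_leading x e K s : e <= 1 -> 0 < K -> exps_gt0 s ->
  small_oh (fun t => x t - t `^ e * (K + psum s t)) -> slt (fun=> 0) x.
Proof.
move=> e1 K0 s0 /small_ohP xs.
have K4 : 0 < K / 4 by rewrite divr_gt0.
have /cvgr_dist_lt/(_ (K / 2)) Ks := expansion_cvg (psum_expansion K s0).
exists (K / 4) => //; near=> t.
have t01 : 0 < t <= 1 by near: t; exact: near0_le1.
have t0 : 0 <= t by rewrite ltW.
have te : t <= t `^ e.
  by have := ger_powR t01 e1; rewrite powRr1.
have : `|x t - t `^ e * (K + psum s t)| <= K / 4 * t by near: t; exact: xs.
have : `|K - (K + psum s t)| < K / 2 by near: t; apply: Ks; rewrite divr_gt0.
rewrite ler_norml ltr_norml => /andP[_ h1] /andP[h2 _].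
have : K / 2 * t <= t `^ e * (K + psum s t).
  rewrite mulrC; apply: ler_pM => //; lra.
rewrite subr0; move: (t `^ e * _) h2 => u; lra.
Unshelve. all: by end_near. Qed.

Lemma powR_expansion (e : R) : 0 < e -> expansion (fun t => t `^ e) 0.
Proof.
move=> e0; exists [:: (1, e)]; first by rewrite /exps_gt0 /= e0.
apply: small_oh_ext small_oh0 => t.
by rewrite psum_cons /psum big_nil /=; ring.
Qed.

(** Strict sorting puts every exponent of [s] above [e], so after dividing by [t ^ e] the remaining
    exponents are still positive. *)
Lemma psum_factor e K s : sorted <%R (e :: unzip2 s) ->
  exists2 s', exps_gt0 s' &
    forall t, 0 < t -> psum ((K, e) :: s) t = t `^ e * (K + psum s' t).
Proof.
move=> es; exists [seq (p.1, p.2 - e) | p <- s].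
  rewrite /exps_gt0 all_map; apply/allP => p ps /=; rewrite subr_gt0.
  move/(order_path_min lt_trans)/allP: es; apply.
  by rewrite /unzip2 map_f.
move=> t t0; rewrite psum_cons mulrDr mulrC; congr (_ + _).
rewrite /psum big_map mulr_sumr; apply: eq_bigr => p _ /=.
rewrite mulrCA -powRD; last by rewrite (gt_eqF t0) implybT.
by rewrite addrC subrK.
Qed.

Lemma psum_leading s : sorted <%R (unzip2 s) ->
  (forall t, psum s t = 0) \/
  exists e K s', [/\ e \in unzip2 s, K != 0, exps_gt0 s' &
    forall t, 0 < t -> psum s t = t `^ e * (K + psum s' t)].
Proof.
elim: s => [_|[k e] s IH]; first by left=> t; rewrite /psum big_nil.
have [->|k0] := eqVneq k 0; last first.
  move=> /(psum_factor k)[s' s'0 E]; right; exists e, k, s'; split => //.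
  by rewrite inE eqxx.
(* A zero coefficient contributes nothing, so the leading term is that of the tail. *)
move=> /= /path_sorted/IH[s0|[e' [K [s' [es K0 s'0 E]]]]].
  by left=> t; rewrite psum_cons mul0r add0r.
right; exists e', K, s'; split => //; first by rewrite inE es orbT.
by move=> t t0; rewrite psum_cons mul0r add0r E.
Qed.

(** Normal form over the exponent list [E]: terms of [s] with equal exponents are merged, and
    exponents of [E] missing from [s] get coefficient 0. Two sums can thereby be written with common
    exponents. *)
Definition coefs s E := [seq \sum_(p <- s | p.2 == e) p.1 | e <- E].

(** Regrouping over [E] loses exactly the terms of exponent above 1, and these are o(t). *)
Lemma psum_coefs s E : exps_gt0 s -> uniq E -> all (fun e => e <= 1) E ->
  (forall p, p \in s -> p.2 <= 1 -> p.2 \in E) ->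
  small_oh (fun t => psum s t - psum (zip (coefs s E) E) t).
Proof.
move=> s0 uE E1 sE.
have -> : psum (zip (coefs s E) E) = (fun t => psum [seq p <- s | p.2 <= 1] t).
  apply/funext => t; rewrite /psum /coefs.
  rewrite -[E in zip _ E]map_id zip_map big_map /=.
  under eq_bigr do rewrite mulr_suml.
  (* After the exchange, each term of [s] is matched against its own exponent, which occurs once in
     [E] if it is at most 1 and not at all otherwise. *)
  rewrite (exchange_big_dep xpredT)//= big_filter [RHS]big_mkcond /=.
  rewrite [LHS]big_seq [RHS]big_seq; apply: eq_bigr => p ps.
  have -> : \sum_(i <- E | p.2 == i) p.1 * t `^ i = \sum_(i <- E | i == p.2) p.1 * t `^ i.
    by apply: eq_bigl => i; rewrite eq_sym.
  case: ifPn => [p1|p1]; first by rewrite -big_filter filter_pred1_uniq ?sE// big_seq1.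
  rewrite big_seq_cond big1// => i /andP[iE /eqP ip]; move: p1.
  by rewrite -ip (allP E1 _ iE).
elim: s s0 {uE E1 sE} => [_|p s IH /=/andP[p0 s0]].
  by apply: small_oh_ext small_oh0 => t; rewrite subrr.
have [p1|p1] := leP p.2 1.
  by apply: small_oh_ext (IH s0) => t; rewrite !psum_cons; ring.
apply: small_oh_ext (small_ohD (_ : small_oh (fun t => p.1 * t `^ p.2)) (IH s0)).
  by move=> t; rewrite !psum_cons addrA.
apply: small_ohM; first exact: bounded_at0_cst.
apply/small_ohP => e e0.
have p10 : 0 < p.2 - 1 by rewrite subr_gt0.
have /cvgr0_norm_le/(_ e e0) H := powR_cvg0 p10.
near=> t.
have t0 : 0 < t by [].
have -> : t `^ p.2 = t `^ (p.2 - 1) * t.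
  rewrite -[X in _ * X]powRr1 ?ltW// -powRD ?subrK//.
  by rewrite (gt_eqF t0) implybT.
by rewrite normrM (gtr0_norm t0) ler_pM2r//; near: t.
Unshelve. all: by end_near. Qed.

Definition exps s := sort <=%R (undup [seq p.2 | p <- s & p.2 <= 1]).

Lemma exps_sorted s : sorted <%R (exps s).
Proof. by rewrite lt_sorted_uniq_le sort_uniq undup_uniq sort_le_sorted. Qed.

Lemma mem_exps s p : p \in s -> p.2 <= 1 -> p.2 \in exps s.
Proof.
move=> ps p1; rewrite mem_sort mem_undup; apply/mapP; exists p => //.
by rewrite mem_filter p1.
Qed.

Lemma expsP s e : e \in exps s -> exists2 p, p \in s & e = p.2 /\ e <= 1.
Proof.
rewrite mem_sort mem_undup => /mapP[p].
by rewrite mem_filter => /andP[p1 ps ->]; exists p.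
Qed.

Lemma exps_gt0_le1 s e : exps_gt0 s -> e \in exps s -> 0 < e <= 1.
Proof. by move=> /allP s0 /expsP[p ps [-> ->]]; rewrite s0. Qed.

(** A nonzero [c] is itself the leading coefficient, with exponent 0. Otherwise the first nonzero
    term of the normalised sum leads, and its exponent is positive; [one_sided_root] later takes a
    root of [t ^ e] and needs this positivity. *)
Lemma leading_term x c : expansion x c -> small_oh x \/
  exists e K s, [/\ 0 <= e <= 1, (c = 0 -> 0 < e), K != 0, exps_gt0 s &
    small_oh (fun t => x t - t `^ e * (K + psum s t))].
Proof.
move=> [s s0 xs]; have [c0|c0] := eqVneq c 0; last first.
  right; exists 0, c, s; split => //; first by rewrite lexx ler01.
    by move=> /eqP; rewrite (negPf c0).
  by apply: small_oh_ext xs => t; rewrite powRr0 mul1r.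
have sE : small_oh (fun t => x t - psum (zip (coefs s (exps s)) (exps s)) t).
  have uE : uniq (exps s) by rewrite sort_uniq undup_uniq.
  have E1 : all (fun e => e <= 1) (exps s).
    by apply/allP => e /(exps_gt0_le1 s0)/andP[].
  have := psum_coefs s0 uE E1 (@mem_exps s).
  by move=> /(small_ohD xs); apply: small_oh_ext => t; rewrite c0; ring.
have /psum_leading : sorted <%R (unzip2 (zip (coefs s (exps s)) (exps s))).
  by rewrite unzip2_zip ?size_map// exps_sorted.
rewrite unzip2_zip ?size_map// => -[z|[e [K [s' [es K0 s'0 E]]]]].
  by left; apply: small_oh_ext sE => t; rewrite z subr0.
have /andP[e0 e1] := exps_gt0_le1 s0 es.
right; exists e, K, s'; split => //; first by rewrite ltW.
apply: small_oh_near sE; near=> t; rewrite E//.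
Unshelve. all: by end_near. Qed.

(** The sign of the leading coefficient of [x - y] decides between the cases. *)
Lemma slt_trichotomy x y c d : expansion x c -> expansion y d ->
  [\/ slt x y, slt y x | small_oh (fun t => x t - y t)].
Proof.
move=> xc yd.
have [|[e [K [s [/andP[_ e1] _ K0 s0 H]]]]] :=
    leading_term (expansionD xc (expansionM (expansion_cst (-1)) yd)).
  by move=> h; apply: Or33; apply: small_oh_ext h => t; ring.
have [Kneg|Kpos|K00] := ltgtP K 0; last by rewrite K00 eqxx in K0.
  apply: Or31; suff : slt (fun=> 0) (fun t => y t - x t).
    by apply: slt_near; apply: nearW => t; ring.
  apply: (@slt_leading _ e (- K) [seq (-1 * p.1, p.2) | p <- s]) => //.
  - by rewrite oppr_gt0.
  - by rewrite /exps_gt0 all_map.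
  - by apply: small_oh_ext (small_ohN H) => t; rewrite psum_scale; ring.
apply: Or32; suff : slt (fun=> 0) (fun t => x t - y t).
  by apply: slt_near; apply: nearW => t; ring.
by apply: (@slt_leading _ e K s) => //; apply: small_oh_ext H => t; ring.
Qed.

Lemma psum_zip_sub (a b : seq R) E t : size a = size E -> size b = size E ->
  psum (zip b E) t - psum (zip a E) t =
  psum (zip [seq p.1 - p.2 | p <- zip b a] E) t.
Proof.
elim: E a b => [|e E IH] [|a0 a] [|b0 b]//=; first by rewrite /psum big_nil subrr.
by move=> [sa] [sb]; rewrite !psum_cons /= -IH//; ring.
Qed.

(** At the first position where the coefficients differ, their difference is the positive leading
    coefficient of the difference of the two sums. *)
Lemma lexi_psum (a b : seq R) E : sorted <%R E -> all (fun e => e <= 1) E ->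
  size a = size E -> size b = size E -> ((a : seqlexi R) <= (b : seqlexi R))%O ->
  a = b \/ slt (psum (zip a E)) (psum (zip b E)).
Proof.
elim: E a b => [|e E IH] [|a0 a] [|b0 b]//=; first by left.
move=> eE /andP[e1 E1] [sa] [sb]; rewrite lexi_cons.
have [ab _|//|ab /=] := ltgtP a0 b0; last first.
  move=> /(IH _ _ (path_sorted eE) E1 sa sb)[->|H]; first by left; rewrite ab.
  right; apply: slt_near H; apply: nearW => t.
  by rewrite !psum_cons ab; ring.
have sz : size [seq p.1 - p.2 | p <- zip b a] = size E.
  by rewrite size_map size_zip sa sb minnn.
right; have [|s s0 H] := @psum_factor e (b0 - a0)
    (zip [seq p.1 - p.2 | p <- zip b a] E).
  by rewrite unzip2_zip ?sz.
suff : slt (fun=> 0) (fun t => psum (zip (b0 :: b) (e :: E)) t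
    - psum (zip (a0 :: a) (e :: E)) t).
  by apply: slt_near; apply: nearW => t /=; ring.
apply: (@slt_leading _ e (b0 - a0) s) => //; first by rewrite subr_gt0.
apply: small_oh_near small_oh0; near=> t.
by rewrite psum_zip_sub /= ?sa ?sb// H// subrr.
Unshelve. all: by end_near. Qed.

End AsymptoticOrder.

(** * The order of Fermat reals in terms of representatives *)

Section FermatOrder.
Context {R : realType}.
Implicit Types (U : set R) (x y z : R -> R).

Definition sle x y : Prop := slt x y \/ small_oh (fun t => x t - y t).

Lemma small_oh_sym x y :
  small_oh (fun t => x t - y t) -> small_oh (fun t => y t - x t).
Proof. by move=> /small_ohN; apply: small_oh_ext => t; ring. Qed.

Lemma small_oh_refl x : small_oh (fun t => x t - x t).
Proof. by apply: small_oh_ext small_oh0 => t; rewrite subrr. Qed.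

Lemma small_oh_trans y x z : small_oh (fun t => x t - y t) ->
  small_oh (fun t => y t - z t) -> small_oh (fun t => x t - z t).
Proof. by move=> h1 h2; apply: small_oh_ext (small_ohD h1 h2) => t; ring. Qed.

Lemma slt_sle x y : slt x y -> sle x y. Proof. by left. Qed.

Lemma sle_small_oh x x' y y' : small_oh (fun t => x t - x' t) ->
  small_oh (fun t => y t - y' t) -> sle x y -> sle x' y'.
Proof.
move=> xx' yy' [xy|xy]; first by left; exact: slt_small_oh xy.
right; apply: small_oh_trans yy'.
exact: small_oh_trans (small_oh_sym xx') xy.
Qed.

Lemma sle_trans y x z : sle x y -> sle y z -> sle x z.
Proof.
move=> xy [yz|yz]; last by apply: sle_small_oh xy => //; exact: small_oh_refl.
case: xy => [xy|xy]; first by left; exact: slt_trans yz.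
left; apply: slt_small_oh yz; last exact: small_oh_refl.
exact: small_oh_sym.
Qed.

Lemma sle_total x y c d : expansion x c -> expansion y d -> sle x y \/ sle y x.
Proof.
move=> xc yd; have [] := slt_trichotomy xc yd; first by left; left.
  by right; left.
by left; right.
Qed.

(** An eventual inequality excludes [slt y x], and for functions with expansions trichotomy leaves
    only the two cases of [sle]. *)
Lemma near_lt_sle x y c d : expansion x c -> expansion y d ->
  (\forall t \near 0^'+, x t < y t) -> sle x y.
Proof.
move=> xc yd xy; have [|/slt_lt yx|] := slt_trichotomy xc yd; [by left| |by right].
by case: (near_lt_asym xy yx).
Qed.

(** The constants are the limits at 0+, so [d < c] would force [y < x] eventually; and functions
    differing by o(t) have the same limit. *)
Lemma expansion_le x y c d : expansion x c -> expansion y d -> sle x y -> c <= d.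
Proof.
move=> xc yd xy; have [//|dc] := leP c d.
have e0 : 0 < (c - d) / 2 by rewrite divr_gt0// subr_gt0.
have /cvgr_dist_lt/(_ _ e0) xcvg := expansion_cvg xc.
have /cvgr_dist_lt/(_ _ e0) ycvg := expansion_cvg yd.
have yx : \forall t \near (0 : R)^'+, y t < x t.
  near=> t.
  have : `|c - x t| < (c - d) / 2 by near: t.
  have : `|d - y t| < (c - d) / 2 by near: t.
  rewrite !ltr_norml => /andP[? ?] /andP[? ?]; lra.
case: xy => [/slt_lt xy|xy]; first by case: (near_lt_asym xy yx).
have xd : expansion x d by exact: expansion_small xy yd.
move: dc.
rewrite (@cvg_unique _ (@norm_hausdorff _ R) _ _ _ _ (expansion_cvg xc)
  (expansion_cvg xd)).
by rewrite ltxx.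
Unshelve. all: by end_near. Qed.

Lemma expansion_unique x y c d : expansion x c -> expansion y d ->
  small_oh (fun t => x t - y t) -> c = d.
Proof.
move=> xc yd xy; apply/eqP; rewrite eq_le; apply/andP; split.
  by apply: expansion_le xc yd _; right.
by apply: expansion_le yd xc _; right; exact: small_oh_sym.
Qed.

Lemma lo_equivE U V x y : little_oh_poly U x -> little_oh_poly V y ->
  small_oh (fun t => x t - y t) -> lo_equiv x y.
Proof.
move=> /little_oh_poly_expansion xE /little_oh_poly_expansion yE xy.
by split => //; exact: expansion_unique xE yE xy.
Qed.

Lemma lexi_power_sum n (E : n.-tuple R) (r s : R) (a b : n.-tuple R) :
  sorted <%R E -> (forall i, 0 < tnth E i <= 1) ->
  ((r :: a : seqlexi R) <= (s :: b : seqlexi R))%O ->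
  (r = s /\ a = b) \/
    slt (fun t => r + power_sum a E t) (fun t => s + power_sum b E t).
Proof.
move=> Es E01 ab.
have Ein e : e \in tval E -> 0 < e <= 1 by move=> /tnthP[i ->].
(* The standard part is treated as the coefficient of [t ^ 0], which turns the comparison into one
   of coefficient lists over [0 :: E]. *)
have E0 : sorted <%R (0 :: tval E).
  by rewrite /= path_min_sorted//; apply/allP => e /Ein/andP[].
have E1 : all (fun e => e <= 1) (0 :: tval E).
  by rewrite /= ler01; apply/allP => e /Ein/andP[].
have [||[-> /val_inj->]|H] := lexi_psum E0 E1 _ _ ab.
- by rewrite /= !size_tuple.
- by rewrite /= !size_tuple.
- by left.
right; apply: slt_near H; apply: nearW => t.
by rewrite /= !psum_cons /= !powRr0 !power_sumE; ring.
Qed.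

Lemma power_sum_lopoly n (E a : n.-tuple R) (r : R) :
  (forall i, 0 < tnth E i) ->
  little_oh_poly setT (fun t => r + power_sum a E t).
Proof.
move=> E0.
have p0 : power_sum a E 0 = 0.
  by rewrite /power_sum big1// => i _; rewrite powR0 ?mulr0// gt_eqF.
split; first by exists 1.
exists n, a, E; split => //; apply: small_oh_ext small_oh0 => t.
by rewrite p0; ring.
Qed.

(** The bridge from the lexicographic definition to asymptotics. For the converse direction both
    classes are decomposed over the exponents at most 1 occurring in either expansion. *)
Lemma fleP (p q : lopoly (@setT R)) : fle (fclass p) (fclass q) <-> sle p q.
Proof.
split.
  move=> [n [E [r [s [a [b [[Es E01]
    [p' /fclassP[_ pp'] p'E] [q' /fclassP[_ qq'] q'E] ab]]]]]]].
  suff : sle p' q' by apply: sle_small_oh; exact: small_oh_sym.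
  rewrite p'E q'E.
  have [[-> ->]|] := lexi_power_sum Es E01 ab; last by left.
  by right; exact: small_oh_refl.
have [s1 s10 pE] := little_oh_poly_expansion (lopolyP p).
have [s2 s20 qE] := little_oh_poly_expansion (lopolyP q).
have s120 : exps_gt0 (s1 ++ s2) by rewrite /exps_gt0 all_cat; apply/andP.
pose E := exps (s1 ++ s2).
have uE : uniq E by rewrite sort_uniq undup_uniq.
have E01 e : e \in E -> 0 < e <= 1 by exact: exps_gt0_le1.
have E1 : all (fun e => e <= 1) E by apply/allP => e /E01/andP[].
have ET01 i : 0 < tnth (in_tuple E) i <= 1 by apply: E01; exact: mem_tnth.
have ET0 i : 0 < tnth (in_tuple E) i by case/andP: (ET01 i).
pose aT (s : seq (R * R)) : (size E).-tuple R :=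
  [tuple of map (fun e => \sum_(p <- s | p.2 == e) p.1) (in_tuple E)].
have decomp (x : lopoly (@setT R)) (s : seq (R * R)) : {subset s <= s1 ++ s2} ->
    exps_gt0 s -> small_oh (fun t => x t - (x 0 + psum s t)) ->
    exists2 x', fclass x = fclass x' &
      lopoly_fun x' = (fun t => x 0 + power_sum (aT s) (in_tuple E) t).
  move=> sub s0 xs; exists (Lopoly (power_sum_lopoly (aT s) (x 0) ET0)) => //.
  apply/fclassP; apply: (lo_equivE (lopolyP x)); first exact: lopolyP.
  apply: small_oh_ext (small_ohD xs (psum_coefs s0 uE E1 _)).
    by move=> t /=; rewrite power_sumE; ring.
  by move=> e /sub; exact: mem_exps.
have [p' pp' p'E] := decomp p s1 (fun e h => ltac:(by rewrite mem_cat h)) s10 pE.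
have [q' qq' q'E] := decomp q s2 (fun e h => ltac:(by rewrite mem_cat h orbT)) s20 qE.
move=> pq; have {}pq : sle p' q'.
  by case/fclassP: pp' => _ ?; case/fclassP: qq' => _ ?; apply: sle_small_oh pq.
exists (size E), (in_tuple E), (p 0), (q 0), (aT s1), (aT s2); split => //.
- by split => //; exact: exps_sorted.
- by exists p'.
- by exists q'.
(* The lexicographic order is total. If it goes the other way, then either the coefficients coincide
   or [q'] is strictly below [p'], against [pq]. *)
have /orP[//|ba] := le_total ((p 0 :: aT s1) : seqlexi R) ((q 0 :: aT s2) : seqlexi R).
have [[-> ->]//|] := lexi_power_sum (E := in_tuple E) (exps_sorted _) ET01 ba.
rewrite -p'E -q'E => qp; case: pq => [/slt_asym/(_ qp)//|pq'].
have := slt_small_oh (small_oh_refl q') pq' qp.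
by move=> h; have := slt_asym h h.
Qed.

End FermatOrder.

(** * Taylor expansion and local sign at a non-flat point *)

Section Taylor.
Context {R : realType}.
Implicit Types (U : set R) (f g : R -> R) (r : R).

(** The mean value theorem on either side of [r] at once; the positive product records that [c] lies
    on the same side of [r] as [s]. *)
Lemma derivable_MVT g r s : s != r ->
  (forall z, `|z - r| <= `|s - r| -> derivable g z 1) ->
  exists c, [/\ `|c - r| <= `|s - r|, 0 < (c - r) * (s - r) &
    g s - g r = (g^`())%classic c * (s - r)].
Proof.
move=> + gd.
have gder z : `|z - r| <= `|s - r| -> is_derive z 1 g ((g^`())%classic z).
  by move=> /gd zd; rewrite derive1E; exact: derivableP.
case: ltgtP => // [sr|rs] _; last first.
  have sub z : z \in `[r, s] -> `|z - r| <= `|s - r|.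
    rewrite in_itv /= => /andP[rz zs].
    by rewrite !ger0_norm ?subr_ge0 ?(ltW rs)// lerD2r.
  have [||c cs ->] := @MVT R g (g^`())%classic r s rs.
  - by move=> z /subset_itv_oo_cc /sub/gder.
  - by apply: derivable_within_continuous => z /sub/gd.
  exists c; split => //; first exact/sub/subset_itv_oo_cc.
  by move: cs; rewrite in_itv /= => /andP[rc _]; rewrite mulr_gt0// subr_gt0.
have sub z : z \in `[s, r] -> `|z - r| <= `|s - r|.
  rewrite in_itv /= => /andP[rz zs].
  by rewrite !(distrC _ r) !ger0_norm ?subr_ge0 ?(ltW sr)// lerD2l lerN2.
have [||c cs gE] := @MVT R g (g^`())%classic s r sr.
- by move=> z /subset_itv_oo_cc /sub/gder.
- by apply: derivable_within_continuous => z /sub/gd.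
exists c; split; first exact/sub/subset_itv_oo_cc.
  by move: cs; rewrite in_itv /= => /andP[_ cr]; rewrite nmulr_rgt0 subr_lt0.
by rewrite -(opprB (g r)) gE -mulrN opprB.
Qed.

Definition taylor n f r : {poly R} := \poly_(i < n) ((f^`(i))%classic r / i`!%:R).

Lemma taylor_deriv n f r : (taylor n.+1 f r)^`() = taylor n (f^`())%classic r.
Proof.
apply/polyP => i; rewrite coef_deriv !coef_poly ltnS.
case: ifP => _; last by rewrite mul0rn.
rewrite -derive1Sn factS natrM -mulr_natr; field.
by rewrite pnatr_eq0 -lt0n fact_gt0 /= addrC natr1 pnatr_eq0.
Qed.

(** Induction on the order: the error of the Taylor polynomial of [f] has as derivative the error
    for [f'], and the mean value theorem supplies one more factor [s - r]. Unlike in [smooth_approx]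
    the polynomial is explicit, so its low coefficients can be read off. *)
Lemma smooth_taylor n U f r : open U -> smooth_on U f -> U r ->
  exists C d : R, [/\ 0 < C, 0 < d &
    forall s, `|s - r| < d -> `|f s - (taylor n f r).[s - r]| <= C * `|s - r| ^+ n].
Proof.
move=> oU + Ur; elim: n f => [|n IH] f fU.
  have fc : f @ r --> f r.
    by apply/differentiable_continuous/derivable1_diffP; exact: (fU 0%N).
  exists (1 + `|f r|).
  move: fc => /cvgr_dist_le/(_ 1 ltr01)/nbhs_ballP[d /= d0 dP].
  exists d; split; [by rewrite ltr_pwDl|by []|].
  move=> s sr; rewrite /taylor poly_def big_ord0 horner0 subr0 expr0 mulr1.
  have -> : f s = (f s - f r) + f r by ring.
  apply: (le_trans (ler_normD _ _)); rewrite lerD2r distrC; apply: dP.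
  by rewrite -ball_normE /= distrC.
have [C [d [C0 d0 H]]] := IH _ (smooth_on_derive1 fU).
have /nbhs_ballP[e /= e0 eU] : nbhs r U by exact: open_nbhs_nbhs.
exists C, (Num.min d e); split => //; first by rewrite lt_min d0 e0.
move=> s; rewrite lt_min => /andP[sd se].
pose P := taylor n.+1 f r \Po ('X - r%:P).
have PE z : P.[z] = (taylor n.+1 f r).[z - r] by rewrite horner_comp !hornerE.
pose g z := f z - P.[z].
have gder z : `|z - r| < e -> is_derive z 1 g
    ((f^`())%classic z - (taylor n (f^`())%classic r).[z - r]).
  move=> ze.
  have -> : (taylor n (f^`())%classic r).[z - r] = P^`().[z].
    by rewrite deriv_comp taylor_deriv derivXsubC mulr1 horner_comp !hornerE.
  apply: (@is_deriveB _ _ _ f (horner P)).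
  rewrite derive1E; apply: derivableP; apply: (fU 0%N).
  by apply: eU; rewrite -ball_normE /= distrC.
have gr : g r = 0.
  by rewrite /g PE subrr horner_coef0 coef_poly /= divr1 subrr.
have [sr|sr] := eqVneq s r.
  rewrite -PE -[X in `|X|]/(g s) sr gr normr0 mulr_ge0 ?exprn_ge0//.
  exact: ltW.
have [z zs|c [cs _]] := @derivable_MVT g r s sr.
  by case: (gder z (le_lt_trans zs se)).
rewrite gr subr0 /g -PE => ->; rewrite normrM exprSr mulrA ler_wpM2r//.
have ce := le_lt_trans cs se.
rewrite derive1E (@derive_val _ _ _ _ _ _ _ (gder _ ce)).
apply: (le_trans (H _ (le_lt_trans cs sd))).
by rewrite ler_pM2l// lerXn2r// nnegrE.
Qed.

Definition order_at f r m :=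
  (forall i, (0 < i < m)%N -> (f^`(i))%classic r = 0) /\ (f^`(m))%classic r != 0.

Lemma order_at_ex f r : (exists m, (0 < m)%N /\ (f^`(m))%classic r != 0) ->
  exists2 m, (0 < m)%N & order_at f r m.
Proof.
move=> [m [m0 fm]].
have ex : exists m, (0 < m)%N && ((f^`(m))%classic r != 0) by exists m; apply/andP.
have [k /andP[k0 fk] kmin] := ex_minnP ex.
exists k => //; split => // i /andP[i0 ik].
apply/eqP; apply: contraTT ik => fi; rewrite -leqNgt; apply: kmin.
by rewrite i0 fi.
Qed.

(** The coefficients of degrees 1 to [m] vanish, so a power of the variable splits off and leaves a
    cofactor with nonzero constant term. *)
Lemma taylor_factor n f r m : order_at f r m.+1 ->
  exists G : {poly R}, G.[0] = (f^`(m.+1))%classic r / (m.+1)`!%:R /\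
    taylor (m.+1 + n.+1) f r = (f r)%:P + 'X^(m.+1) * G.
Proof.
move=> [fi fm].
exists (\poly_(i < n.+1) ((f^`(m.+1 + i))%classic r / (m.+1 + i)`!%:R)); split.
  by rewrite horner_coef0 coef_poly addn0.
apply/polyP => i; rewrite coefD coefC coefXnM !coef_poly.
case: i => [|i]; first by rewrite /= divr1 addr0.
rewrite [X in X + _]/= add0r; case: (ltnP i.+1 m.+1) => im.
  by rewrite fi ?mul0r ?if_same.
rewrite -{1}(subnKC im) ltn_add2l; case: ifP => // _.
by rewrite subnKC.
Qed.

(** Near [r] the derivative is [K / m! * (s - r) ^ m] up to a smaller error, so it has the sign of
    that term. *)
Lemma order_at_derive_sign U f r m : open U -> smooth_on U f -> U r ->
  order_at f r m.+1 -> exists2 d : R, 0 < d & forall s, `|s - r| < d -> s != r ->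
    U s /\ 0 < (f^`())%classic s * (s - r) ^+ m * (f^`(m.+1))%classic r.
Proof.
move=> oU fU Ur [fi fm].
have [C [d [C0 d0 H]]] := smooth_taylor m.+1 oU (smooth_on_derive1 fU) Ur.
have /nbhs_ballP[e /= e0 eU] : nbhs r U by exact: open_nbhs_nbhs.
set K := (f^`(m.+1))%classic r in fm *.
have K0 : 0 < `|K| / m`!%:R by rewrite divr_gt0 ?normr_gt0// ltr0n fact_gt0.
(* The last bound makes the remainder [C * |s - r| ^ m.+1] smaller than the main term
   [|K| / m! * |s - r| ^ m]. *)
pose d' := Num.min (Num.min d e) (`|K| / m`!%:R / C).
exists d'; first by rewrite !lt_min d0 e0 divr_gt0.
move=> s; rewrite !lt_min => /andP[/andP[sd se] sK] sr.
split; first by apply: eU; rewrite -ball_normE /= distrC.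
have := H _ sd.
have -> : (taylor m.+1 (f^`())%classic r).[s - r] = K / m`!%:R * (s - r) ^+ m.
  rewrite /taylor poly_def horner_sum big_ord_recr /= big1 => [|i _].
    by rewrite add0r hornerZ hornerXn -derive1Sn.
  by rewrite -derive1Sn fi ?mul0r ?scale0r ?horner0//= ltnS.
move: (f^`() s)%classic => fs.
rewrite exprSr -normrX; set h := (s - r) ^+ m.
have h0 : 0 < `|h| by rewrite normr_gt0 expf_neq0// subr_eq0.
set F := (m`!%:R : R) in K0 sK *.
have F0 : 0 < F by rewrite ltr0n fact_gt0.
move: sK; rewrite ltr_pdivlMr// => sK bound.
have {}bound : `|fs - K / F * h| < `|K / F * h|.
  apply: (le_lt_trans bound); rewrite normrM normf_div (gtr0_norm F0).
  by rewrite mulrCA [_ * `|h|]mulrC ltr_pM2l// mulrC.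
have : 0 < fs * (K / F * h).
  have u0 : 0 < `|K / F * h| by exact: le_lt_trans bound.
  move: (K / F * h) bound u0 => u; rewrite normr_gt0.
  case: (ltgtP u 0) => // u0; [rewrite (ltr0_norm u0)|rewrite (gtr0_norm u0)];
    rewrite ltr_norml => /andP[? ?] _; [rewrite nmulr_lgt0//|rewrite pmulr_lgt0//]; lra.
have -> : fs * (K / F * h) = F^-1 * (fs * h * K) by field; rewrite gt_eqF.
by rewrite pmulr_rgt0// invr_gt0.
Qed.

(** The mean value theorem reduces this to the sign of the derivative at a point [c] on the same
    side of [r] as [s]; trading powers of [c - r] for powers of [s - r] therefore costs only a
    positive factor. *)
Lemma order_at_sign U f r m : open U -> smooth_on U f -> U r ->
  order_at f r m.+1 -> exists2 d : R, 0 < d & forall s, `|s - r| < d -> s != r ->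
    0 < (f s - f r) * (s - r) ^+ m.+1 * (f^`(m.+1))%classic r.
Proof.
move=> oU fU Ur fm; have [d d0 H] := order_at_derive_sign oU fU Ur fm.
exists d => // s sd sr.
have [z zs|c [cs csr ->]] := @derivable_MVT f r s sr.
  have [->|zr] := eqVneq z r; first exact: (fU 0%N).
  by apply: (fU 0%N); case: (H _ (le_lt_trans zs sd) zr).
have c0 : c - r != 0 by apply: contraTneq csr => ->; rewrite mul0r ltxx.
have [|_ Hc] := H _ (le_lt_trans cs sd); first by rewrite -subr_eq0.
have q0 : 0 < (s - r) / (c - r).
  have -> : (s - r) / (c - r) = (c - r) * (s - r) / (c - r) ^+ 2 by field.
  by rewrite divr_gt0// exprn_even_gt0.
have -> : (f^`())%classic c * (s - r) * (s - r) ^+ m.+1 * (f^`(m.+1))%classic r =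
    (f^`())%classic c * (c - r) ^+ m * (f^`(m.+1))%classic r *
    (((s - r) / (c - r)) ^+ m * (s - r) ^+ 2).
  have -> : (s - r) ^+ m.+1 = ((s - r) / (c - r)) ^+ m * (c - r) ^+ m * (s - r).
    by rewrite -exprMn divfK// exprSr.
  ring.
rewrite mulr_gt0// mulr_gt0//; first exact: exprn_gt0.
by rewrite exprn_even_gt0// subr_eq0.
Qed.

End Taylor.

(** * Newton iteration for a polynomial equation with a parameter *)

Section ApproximateRoots.
Context {R : realType}.
Implicit Types (Q G : {poly R}).

Lemma horner_lipschitz Q (M : R) : 0 <= M -> exists2 L, 0 < L &
  forall x y, `|x| <= M -> `|y| <= M -> `|Q.[x] - Q.[y]| <= L * `|x - y|.
Proof.
move=> M0; elim/poly_ind: Q => [|Q a [L L0 H]].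
  by exists 1 => // x y _ _; rewrite !horner0 subrr normr0 mul1r.
exists (M * L + (L * M + `|Q.[0]|) + 1).
  by rewrite ltr_wpDl// !addr_ge0// mulr_ge0// ltW.
move=> x y xM yM; rewrite !hornerMXaddC.
have -> : Q.[x] * x + a - (Q.[y] * y + a) =
  x * (Q.[x] - Q.[y]) + (x - y) * ((Q.[y] - Q.[0]) + Q.[0]) by ring.
apply: (le_trans (ler_normD _ _)); rewrite !normrM.
have h1 : `|x| * `|Q.[x] - Q.[y]| <= M * (L * `|x - y|) by rewrite ler_pM// H.
have h2 : `|Q.[y] - Q.[0] + Q.[0]| <= L * M + `|Q.[0]|.
  apply: (le_trans (ler_normD _ _)); rewrite lerD2r.
  apply: (le_trans (H _ _ yM _)); first by rewrite normr0.
  by rewrite subr0 ler_pM2l.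
have := ler_wpM2l (normr_ge0 (x - y)) h2.
by have := normr_ge0 (x - y); lra.
Qed.

Lemma horner_scaled_lipschitz G k (M : R) : 0 <= M -> exists2 L, 0 < L &
  forall (u x y : R), 0 <= u <= 1 -> `|x| <= M -> `|y| <= M ->
  `|x ^+ k * G.[u * x] - y ^+ k * G.[u * y]| <= L * `|x - y|.
Proof.
move=> M0; elim/poly_ind: G k => [|G a IH] k.
  by exists 1 => // u x y _ _ _; rewrite !horner0 !mulr0 subrr normr0 mul1r.
have [L L0 H] := IH k.+1; have [L' L'0 H'] := horner_lipschitz 'X^k M0.
exists (L + `|a| * L'); first by rewrite ltr_pwDl// mulr_ge0// ltW.
move=> u x y u01 xM yM; rewrite !hornerMXaddC.
have -> : x ^+ k * (G.[u * x] * (u * x) + a) - y ^+ k * (G.[u * y] * (u * y) + a) =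
    u * (x ^+ k.+1 * G.[u * x] - y ^+ k.+1 * G.[u * y]) + a * (x ^+ k - y ^+ k).
  by rewrite !exprSr; ring.
apply: (le_trans (ler_normD _ _)); rewrite !normrM mulrDl lerD//.
  case/andP: u01 => u0 u1; rewrite (ger0_norm u0).
  apply: le_trans (H u x y _ xM yM); last by rewrite u0.
  by rewrite ler_piMl.
by rewrite -mulrA ler_wpM2l//; have := H' _ _ xM yM; rewrite !hornerXn.
Qed.

Lemma horner_linearization Q (c M : R) : `|c| <= M -> exists2 L, 0 < L &
  forall x y, `|x| <= M -> `|y| <= M ->
  `|Q.[x] - Q.[y] - Q^`().[c] * (x - y)| <= L * (`|x - c| + `|y - c|) * `|x - y|.
Proof.
move=> cM; have M0 : 0 <= M by exact: le_trans cM.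
elim/poly_ind: Q => [|Q a [L L0 H]].
  exists 1 => // x y _ _; rewrite deriv0 !horner0 mul0r !subr0 normr0 mul1r.
  by rewrite mulr_ge0// addr_ge0.
have [L' L'0 H'] := horner_lipschitz Q M0.
exists (M * L + `|Q^`().[c]| + L').
  by rewrite ltr_wpDl// addr_ge0// mulr_ge0// ltW.
move=> x y xM yM.
rewrite derivMXaddC !hornerE.
have -> : Q.[x] * x + a - (Q.[y] * y + a) - (Q.[c] + Q^`().[c] * c) * (x - y) =
  x * (Q.[x] - Q.[y] - Q^`().[c] * (x - y)) + (x - c) * Q^`().[c] * (x - y)
  + (Q.[y] - Q.[c]) * (x - y) by ring.
have := H _ _ xM yM; have := H' _ _ yM cM.
move: (Q.[x] - Q.[y] - _) => A; move: (Q.[y] - Q.[c]) => B hB hA.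
apply: (le_trans (ler_normD _ _)).
apply: (le_trans (lerD (ler_normD _ _) (lexx _))); rewrite !normrM.
set p := `|x - c| in hA *; set q := `|y - c| in hA hB *; set d := `|x - y| in hA *.
have p0 : 0 <= p by rewrite /p.
have q0 : 0 <= q by rewrite /q.
have d0 : 0 <= d by rewrite /d.
have -> : (M * L + `|Q^`().[c]| + L') * (p + q) * d =
  M * L * (p + q) * d + `|Q^`().[c]| * (p + q) * d + L' * (p + q) * d by ring.
apply: lerD; first apply: lerD.
- by rewrite -!mulrA ler_pM// mulrA.
- by rewrite [p * _]mulrC ler_wpM2r// ler_wpM2l// lerDl.
- by rewrite ler_wpM2r//; apply: (le_trans hB); rewrite ler_pM2l// lerDr.
Qed.

Lemma hensel_contraction G m (c M : R) : `|c| <= M -> exists2 L, 0 < L &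
  forall u x y : R, 0 <= u <= 1 -> `|x| <= M -> `|y| <= M ->
  `|x ^+ m * G.[u * x] - y ^+ m * G.[u * y] - G.[0] * c ^+ m.-1 *+ m * (x - y)|
    <= L * (`|x - c| + `|y - c| + u) * `|x - y|.
Proof.
move=> cM; have M0 : 0 <= M by exact: le_trans cM.
elim/poly_ind: G => [|G a _].
  exists 1 => // u x y /andP[u0 _] _ _.
  rewrite !horner0 !mulr0 mul0r mul0rn mul0r !subr0 normr0 mul1r.
  by rewrite mulr_ge0// !addr_ge0.
have [L L0 H] := horner_scaled_lipschitz G m.+1 M0.
have [L' L'0 H'] := horner_linearization 'X^m cM.
exists (`|a| * L' + L); first by rewrite ltr_wpDl// mulr_ge0// ltW.
move=> u x y u01 xM yM; have := H' x y xM yM; have := H u x y u01 xM yM.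
rewrite derivXn hornerMn !hornerXn !hornerMXaddC mulr0 add0r.
have -> : x ^+ m * (G.[u * x] * (u * x) + a) - y ^+ m * (G.[u * y] * (u * y) + a)
    - a * c ^+ m.-1 *+ m * (x - y) =
    a * (x ^+ m - y ^+ m - c ^+ m.-1 *+ m * (x - y)) +
    u * (x ^+ m.+1 * G.[u * x] - y ^+ m.+1 * G.[u * y]).
  by rewrite !exprSr -mulrnAr; ring.
move: (x ^+ m.+1 * _ - _) => A; move: (x ^+ m - y ^+ m - _) => B hA hB.
apply: (le_trans (ler_normD _ _)); rewrite !normrM.
case/andP: u01 => u0 u1; rewrite (ger0_norm u0).
set d := `|x - y| in hA hB *; set w := `|x - c| + `|y - c| in hB *.
have w0 : 0 <= w by rewrite /w addr_ge0.
have d0 : 0 <= d by rewrite /d.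
have h1 : `|a| * `|B| <= `|a| * (L' * w * d) by rewrite ler_wpM2l.
have h2 : u * `|A| <= u * (L * d) by rewrite ler_wpM2l.
have h3 : 0 <= `|a| * (L' * u * d) by rewrite !mulr_ge0// ltW.
have h4 : 0 <= L * w * d by rewrite !mulr_ge0// ltW.
lra.
Qed.

(* Simplified Newton iteration: the derivative is frozen to its value d at the
   constant approximation c. *)
Fixpoint hensel (F : R -> R -> R) (d c : R) (k : nat) : R -> R :=
  if k is k'.+1 then fun t => hensel F d c k' t - F t (hensel F d c k' t) / d
  else fun=> c.

(* Each step gains a fixed power t^e, where e bounds the order of the initial
   residual and of t^b, so finitely many steps reach any order N. *)
Lemma approx_root G m (b K c : R) (z : R -> R) N : (0 < m)%N -> 0 < b -> c != 0 ->
  G.[0] * c ^+ m = K -> K != 0 -> expansion z 0 ->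
  exists2 x, expansion x c & exists2 C : R, 0 < C & exists2 a : R, N%:R <= a &
    \forall t \near 0^'+, `|x t ^+ m * G.[t `^ b * x t] - (K + z t)| <= C * t `^ a.
Proof.
move=> m0 b0 c0 GK K0 zE.
pose F t x := x ^+ m * G.[t `^ b * x] - (K + z t).
pose d := G.[0] * c ^+ m.-1 *+ m.
have d0 : d != 0.
  rewrite /d mulrn_eq0 negb_or -lt0n m0 /= mulf_neq0 ?expf_neq0//.
  by apply: contra_neq K0 => G0; rewrite -GK G0 mul0r.
have bE := powR_expansion b0.
have FE x : expansion x c -> expansion (fun t => F t (x t)) 0.
  move=> xE; have uE := expansion_horner G (expansionM bE xE).
  have xmE : expansion (fun t => x t ^+ m) (c ^+ m).
    have := expansion_horner 'X^m xE; rewrite hornerXn.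
    by under eq_fun do rewrite hornerXn.
  have KzE := expansionM (expansion_cst (-1)) (expansionD (expansion_cst K) zE).
  have := expansionD (expansionM xmE uE) KzE.
  rewrite mul0r mulrC GK; have -> : K + -1 * (K + 0) = 0 by ring.
  by congr expansion; apply/funext => t; rewrite /F; ring.
have hE k : expansion (hensel F d c k) c.
  elim: k => [|k IH] /=; first exact: expansion_cst.
  have := expansionD IH (expansionM (FE _ IH) (expansion_cst (- d^-1))).
  rewrite mul0r addr0; congr expansion; apply/funext => t; ring.
have [e' [C0 [e'0 C00 F0]]] := expansion_pow (FE _ (hE 0%N)).
pose e := Num.min e' b.
have e0 : 0 < e by rewrite lt_min e'0.
have small := @near0_le1 R.
(* Each iterate tends to [c], so it eventually stays in the ball of radius [|c| + 1]. *)
have [L L0 HL] := @hensel_contraction G m c (`|c| + 1) (ltac:(by rewrite lerDl)).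
have bounded k : \forall t \near (0:R)^'+, `|hensel F d c k t| <= `|c| + 1.
  have /cvgr_dist_le/(_ 1 ltr01) H := expansion_cvg (hE k).
  near=> t; have -> : hensel F d c k t = c - (c - hensel F d c k t) by ring.
  by apply: (le_trans (ler_normB _ _)); rewrite lerD2l; near: t.
have key k : exists2 C : R, 0 < C & \forall t \near 0^'+,
    `|hensel F d c k t - c| <= C * t `^ e /\
    `|F t (hensel F d c k t)| <= C * t `^ (e * k.+1%:R).
  elim: k => [|k [C Cp H]].
    exists C0 => //; near=> t; split.
      by rewrite /= subrr normr0 mulr_ge0 ?powR_ge0// ltW.
    have : `|F t (hensel F d c 0 t) - 0| <= C0 * t `^ e' by near: t.
    rewrite subr0 => /le_trans; apply; rewrite mulr1 ler_pM2l//.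
    have /ger_powR : 0 < t <= 1 by near: t.
    by apply; rewrite ge_min lexx.
  have nd0 : 0 < `|d^-1| by rewrite normr_gt0 invr_eq0.
  (* [C1] controls the distance of the next iterate from [c], and [C2] its residual; their sum
     serves for both. *)
  pose C1 := C + C * `|d^-1|.
  have C10 : 0 < C1 by rewrite addr_gt0// mulr_gt0.
  pose C2 := L * (C1 + C + 1) * (C * `|d^-1|).
  have C20 : 0 < C2 by do ?[apply: mulr_gt0 => //|apply: addr_gt0 => //].
  exists (C1 + C2); first by rewrite addr_gt0.
  near=> t.
  have t01 : 0 < t <= 1 by near: t.
  have [Hx HF] : `|hensel F d c k t - c| <= C * t `^ e /\
    `|F t (hensel F d c k t)| <= C * t `^ (e * k.+1%:R) by near: t.
  have te0 : 0 <= t `^ e by exact: powR_ge0.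
  have tk : t `^ (e * k.+1%:R) <= t `^ e.
    by apply: (ger_powR t01); rewrite ler_peMr ?ler1n// ltW.
  have te : t `^ (e * k.+2%:R) = t `^ e * t `^ (e * k.+1%:R).
    rewrite -powRD; last by rewrite (gt_eqF (proj1 (andP t01))) implybT.
    by rewrite -[k.+2]add1n natrD; congr (_ `^ _); ring.
  have step : `|hensel F d c k.+1 t - hensel F d c k t| <=
      C * `|d^-1| * t `^ (e * k.+1%:R).
    rewrite /= addrAC subrr add0r normrN normrM mulrAC ler_wpM2r//.
  have Hx' : `|hensel F d c k.+1 t - c| <= C1 * t `^ e.
    have -> : hensel F d c k.+1 t - c =
      (hensel F d c k t - c) + (hensel F d c k.+1 t - hensel F d c k t) by ring.
    apply: (le_trans (ler_normD _ _)); rewrite mulrDl lerD//.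
    by apply: (le_trans step); rewrite ler_pM2l// mulr_gt0.
  split.
    by apply: (le_trans Hx'); rewrite ler_wpM2r// lerDl ltW.
  have tb : t `^ b <= t `^ e by apply: (ger_powR t01); rewrite ge_min lexx orbT.
  have u01 : 0 <= t `^ b <= 1.
    rewrite powR_ge0 -[leRHS](powRr0 t); apply: (ger_powR t01); exact: ltW.
  have := HL (t `^ b) (hensel F d c k.+1 t) (hensel F d c k t) u01
    (near (bounded k.+1) t _) (near (bounded k) t _).
  (* The Newton step is chosen so that the linear term cancels the old residual; what the
     contraction estimate bounds is then exactly the new residual. *)
  have -> : hensel F d c k.+1 t ^+ m * G.[t `^ b * hensel F d c k.+1 t] -
      hensel F d c k t ^+ m * G.[t `^ b * hensel F d c k t] -
      G.[0] * c ^+ m.-1 *+ m * (hensel F d c k.+1 t - hensel F d c k t) =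
      F t (hensel F d c k.+1 t).
    have hS : hensel F d c k.+1 t =
      hensel F d c k t - F t (hensel F d c k t) / d by [].
    have -> : G.[0] * c ^+ m.-1 *+ m * (hensel F d c k.+1 t - hensel F d c k t) =
        - F t (hensel F d c k t).
      by rewrite hS -/d [_ - _ / _ - _]addrAC subrr add0r mulrN mulrCA mulfV ?mulr1.
    by rewrite /F; ring.
  move=> h; rewrite te; apply: (le_trans (h _ _)) => //.
  apply: (@le_trans _ _ (C2 * (t `^ e * t `^ (e * k.+1%:R)))).
    rewrite /C2 mulrACA; apply: ler_pM => //.
      by rewrite mulr_ge0 ?addr_ge0 ?powR_ge0// ltW.
    by rewrite -[leRHS]mulrA ler_pM2l// 2!mulrDl mul1r; apply: lerD => //; exact: lerD.
  by rewrite ler_wpM2r ?mulr_ge0 ?powR_ge0// lerDr ltW.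
exists (hensel F d c (Num.bound (N%:R / e))); first exact: hE.
have [C Cp H] := key (Num.bound (N%:R / e)).
exists C => //; exists (e * (Num.bound (N%:R / e)).+1%:R).
  rewrite mulrC -ler_pdivrMr// ltW// (lt_trans (archi_boundP _))//.
    by rewrite divr_ge0// ltW.
  by rewrite ltr_nat.
by apply: filterS H => t [].
Unshelve. all: by end_near. Qed.

End ApproximateRoots.

(** * Solving the equation on an interval of strict monotonicity *)

Section MonotonePieces.
Context {R : realType}.
Implicit Types (U J : set R) (f x y : R -> R).

Lemma pow_small_oh x (C e : R) : 0 < C -> 2 <= e ->
  (\forall t \near 0^'+, `|x t| <= C * t `^ e) -> small_oh x.
Proof.
move=> C0 e2 H; apply/small_ohP => d d0.
have dC : 0 < d / C by rewrite divr_gt0.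
near=> t.
have t0 : 0 < t by [].
have t1 : t <= 1 by apply: ltW; near: t; exact: nbhs_right_lt.
have td : t <= d / C by apply: ltW; near: t; exact: nbhs_right_lt.
have : `|x t| <= C * t `^ e by near: t.
move=> /le_trans; apply; apply: (@le_trans _ _ (C * t `^ 2)).
  by rewrite ler_pM2l//; apply: ger_powR => //; rewrite t0.
rewrite (powR_mulrn 2)// ?(ltW t0)// expr2 mulrA ler_pM2r//.
by rewrite mulrC -ler_pdivlMr.
Unshelve. all: by end_near. Qed.

Lemma sqr1_cases (s : R) : s ^+ 2 = 1 -> s = 1 \/ s = -1.
Proof. by move=> /eqP; rewrite sqrf_eq1 => /orP[]/eqP; [left|right]. Qed.

(* sg tells on which side of c0 the root lies and tau whether y lies above or
   below f c0; the values of f near c0 are what rules out even order with the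
   wrong sign. *)
Lemma one_sided_root U f y (c0 : R) m (sg tau : R) :
  open U -> smooth_on U f -> U c0 -> order_at f c0 m.+1 ->
  sg ^+ 2 = 1 -> tau ^+ 2 = 1 -> expansion y (f c0) ->
  slt (fun=> 0) (fun t => tau * (y t - f c0)) ->
  (forall d : R, 0 < d -> exists s,
    [/\ `|s - c0| < d, 0 < sg * (s - c0) & 0 < tau * (f s - f c0)]) ->
  exists c, [/\ expansion c c0, c 0 = c0,
    \forall t \near 0^'+, 0 < sg * (c t - c0) & small_oh (fun t => f (c t) - y t)].
Proof.
move=> oU fU Uc0 fm sg2 tau2 yE ytau near_s.
have sgK : sg * sg = 1 by rewrite -expr2.
have tauK : tau * tau = 1 by rewrite -expr2.
set D := (f^`(m.+1))%classic c0 in fm.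
(* This sign condition makes the leading equation solvable on the side [sg]. It comes from comparing
   the sign given by [order_at_sign] with a value of [f] at a nearby point on that side. *)
have tsD : 0 < tau * sg ^+ m.+1 * D.
  have [d d0 H] := order_at_sign oU fU Uc0 fm.
  have [s [sd ssg stau]] := near_s _ d0.
  have sc0 : s != c0 by apply: contraTneq ssg => ->; rewrite subrr mulr0 ltxx.
  have := H _ sd sc0; rewrite -/D.
  have : 0 < (s - c0) ^+ m.+1 * sg ^+ m.+1.
    by rewrite -exprMn mulrC exprn_gt0// mulrC.
  move: (f s - f c0) stau ((s - c0) ^+ m.+1) (sg ^+ m.+1) => F tF h q hq FhD.
  have := mulr_gt0 (mulr_gt0 tF hq) FhD.
  have -> : tau * F * (h * q) * (F * h * D) = (F * h) ^+ 2 * (tau * q * D) by ring.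
  rewrite pmulr_rgt0// exprn_even_gt0//.
  by apply: contraTneq FhD => ->; rewrite mul0r ltxx.
have yE0 : expansion (fun t => y t - f c0) 0.
  by have := expansion_shift (f c0) yE; rewrite subrr.
have not_slt0 (x : R -> R) : slt (fun=> 0) x -> small_oh x -> False.
  move=> h1 h2; have h : slt (fun=> 0 : R) (fun=> 0).
    apply: slt_small_oh h1; first exact: small_oh_refl.
    by apply: small_oh_ext h2 => t; rewrite subr0.
  exact: (slt_asym h h).
have [ysmall|[e [K [s [/andP[_ e1] /(_ erefl) e0 K0 s0 ys]]]]] := leading_term yE0.
  exfalso; apply: (not_slt0 _ ytau).
  exact: small_ohM (bounded_at0_cst tau) ysmall.
have tauK0 : 0 < tau * K.
  have [//|tK|tK] := ltgtP 0 (tau * K).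
    have slt' : slt (fun=> 0) (fun t => - (tau * (y t - f c0))).
      apply: (@slt_leading _ _ e (- (tau * K)) [seq (- tau * p.1, p.2) | p <- s]) => //.
      - by rewrite oppr_gt0.
      - by rewrite /exps_gt0 all_map.
      - have := small_ohM (bounded_at0_cst (- tau)) ys.
        by apply: small_oh_ext => t; rewrite psum_scale; ring.
    exfalso; apply: (slt_asym ytau); apply: slt_near slt'.
    by apply: nearW => t; ring.
  move: K0; rewrite -(mul1r K) -tauK -mulrA -tK mulr0 eqxx => //.
pose F := (m.+1)`!%:R : R.
have F0 : 0 < F by rewrite ltr0n fact_gt0.
have D0 : D != 0 by case: fm.
pose G0 := D / F.
have G00 : G0 != 0 by rewrite mulf_neq0 ?invr_eq0// gt_eqF.
(* The leading equation is [G0 * eta ^ m.+1 = K]; with [eta = sg * |eta|] it reads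
   [|eta| ^ m.+1 = q], so positivity of [q] provides the real root. *)
pose q := K * sg ^+ m.+1 / G0.
have sgm : sg ^+ m.+1 * sg ^+ m.+1 = 1 by rewrite -exprMn sgK expr1n.
have q0 : 0 < q.
  have : 0 < (tau * K) * (tau * sg ^+ m.+1 * D) by rewrite mulr_gt0.
  have -> : (tau * K) * (tau * sg ^+ m.+1 * D) = (tau * tau) * (F * G0 ^+ 2) * q.
    by rewrite /q /G0; field; rewrite D0 gt_eqF.
  rewrite tauK mul1r pmulr_rgt0// mulr_gt0// exprn_even_gt0//.
pose eta := sg * q `^ (m.+1%:R^-1).
have etaE : G0 * eta ^+ m.+1 = K.
  rewrite exprMn -[(q `^ _) ^+ _]powR_mulrn ?powR_ge0// -powRrM mulVf ?pnatr_eq0//.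
  rewrite powRr1 ?ltW// /q; transitivity (sg ^+ m.+1 * sg ^+ m.+1 * K).
    by field.
  by rewrite sgm mul1r.
have sgeta : 0 < sg * eta by rewrite /eta mulrA sgK mul1r powR_gt0.
have eta0 : eta != 0 by apply: contraTneq sgeta => ->; rewrite mulr0 ltxx.
pose b := e / m.+1%:R.
have b0 : 0 < b by rewrite divr_gt0// ltr0n.
(* Since [c - c0] is O(t^b), a Taylor remainder of order at least [n] is O(t^2), hence o(t). *)
pose n := Num.bound (2 / b).
have [G [G0E tE]] := taylor_factor n fm.
have zE : expansion (psum s) 0.
  by have := psum_expansion 0 s0; congr expansion; apply/funext => t; rewrite add0r.
have [x xE [C C0 [p p2 H]]] := @approx_root _ G m.+1 b K eta (psum s) 2
  isT b0 eta0 (etrans (congr1 (fun u => u * _) G0E) etaE) K0 zE.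
have bE := powR_expansion b0.
exists (fun t => c0 + t `^ b * x t).
have cE : expansion (fun t => c0 + t `^ b * x t) c0.
  by have := expansionD (expansion_cst c0) (expansionM bE xE); rewrite mul0r addr0.
split => //.
- by rewrite powR0 ?gt_eqF// mul0r addr0.
- have /cvgr_dist_lt/(_ _ sgeta) := expansion_cvg (expansionM (expansion_cst sg) xE).
  move=> xsg; near=> t; rewrite addrAC subrr add0r mulrCA mulr_gt0 ?powR_gt0//.
  have : `|sg * eta - sg * x t| < sg * eta by near: t.
  by rewrite ltr_norml => /andP[_]; lra.
have [B B0 xB] := expansion_bounded xE.
have [A [d [A0 d0 fA]]] := smooth_taylor (m.+1 + n.+1) oU fU Uc0.
have ftaylor : small_oh (fun t => f (c0 + t `^ b * x t) -
    (taylor (m.+1 + n.+1) f c0).[c0 + t `^ b * x t - c0]).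
  apply: (approx_small_oh A0 d0 fA cE B0 (a := b)).
    rewrite mulrC -ler_pdivrMr//; apply: (@le_trans _ _ n%:R).
      by apply/ltW/archi_boundP; rewrite divr_ge0// ltW.
    by rewrite ler_nat addnS ltnW// ltnS leq_addl.
  near=> t; rewrite addrAC subrr add0r normrM mulrC.
  rewrite [X in _ * X]ger0_norm ?powR_ge0// ler_wpM2r ?powR_ge0//.
  by near: t.
have xroot := pow_small_oh C0 p2 H.
have te : bounded_at0 (fun t : R => t `^ e).
  exists 1 => //; near=> t; rewrite ger0_norm ?powR_ge0// -[leRHS](powRr0 t).
  apply: ger_powR; last exact: ltW.
  by near: t; exact: near0_le1.
apply: small_oh_ext (small_ohD ftaylor
  (small_ohD (small_ohM te xroot) (small_ohN ys))) => t.
(* The choice of [b] gives both sides of the equation the same factor [t ^ e], so the residual of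
   [x] times [t ^ e] is the residual of [c]. *)
have -> : t `^ e = (t `^ b) ^+ m.+1.
  by rewrite -[RHS]powR_mulrn ?powR_ge0// -powRrM divfK// pnatr_eq0.
rewrite tE !hornerE addrAC subrr add0r exprMn /=; ring.
Unshelve. all: by end_near. Qed.

Lemma near0_interval (P : R -> Prop) : (\forall t \near 0^'+, P t) ->
  exists2 e : R, 0 < e & forall t, 0 < t < e -> P t.
Proof.
move=> /nbhs_ballP[e /= e0 H]; exists e => // t /andP[t0 te].
by apply: H => //; rewrite -ball_normE /= sub0r normrN gtr0_norm.
Qed.

Lemma near_little_oh_poly U x : U (x 0) -> (\forall t \near 0^'+, U (x t)) ->
  expansion x (x 0) -> little_oh_poly U x.
Proof.
move=> U0 /near0_interval[e e0 H]; apply: expansion_little_oh_poly.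
exists e => // t /andP[]; rewrite le_eqVlt => /orP[/eqP<-//|t0 te].
by apply: H; rewrite t0.
Qed.

(* rho is 1 or -1 according to whether f increases or decreases on J. *)
Lemma monotone_root U J f (rho : R) (a b : R -> R) y : open U -> smooth_on U f ->
  (forall u, U u -> exists m, (0 < m)%N /\ (f^`(m))%classic u != 0) ->
  J `<=` U -> is_interval J -> rho ^+ 2 = 1 ->
  (forall s s', J s -> J s' -> s < s' -> rho * f s < rho * f s') ->
  little_oh_poly J a -> little_oh_poly J b -> little_oh_poly setT y ->
  slt (fun t => rho * f (a t)) (fun t => rho * y t) ->
  slt (fun t => rho * y t) (fun t => rho * f (b t)) ->
  exists c, [/\ little_oh_poly J c, sle a c, sle c b &
    small_oh (fun t => f (c t) - y t)].
Proof.
move=> oU fU nf JU iJ rho2 fmono aP bP yP ay yb.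
have rhoK : rho * rho = 1 by rewrite -expr2.
have fle s s' : J s -> J s' -> rho * f s < rho * f s' -> s < s'.
  move=> Js Js' ss'; rewrite ltNge le_eqVlt; apply/negP => /orP[/eqP s's|/fmono].
    by rewrite s's ltxx in ss'.
  by move=> /(_ Js' Js) /(lt_trans ss'); rewrite ltxx.
have sub x : little_oh_poly J x -> little_oh_poly U x.
  by move=> [[e e0 xJ] xE]; split => //; exists e => // t /xJ/JU.
have nearJ x : little_oh_poly J x -> \forall t \near 0^'+, J (x t).
  move=> [[e e0 xJ] _]; near=> t; apply: xJ; apply/andP; split; first exact: ltW.
  by near: t; exact: nbhs_right_lt.
have rE x d : expansion x d -> expansion (fun t => rho * x t) (rho * d).
  by move=> /(expansionM (expansion_cst rho)).
have fE x : little_oh_poly J x -> expansion (fun t => f (x t)) (f (x 0)).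
  by move=> /sub/(little_oh_poly_comp oU fU)/little_oh_poly_expansion.
have aE := little_oh_poly_expansion aP; have bE := little_oh_poly_expansion bP.
have yE := little_oh_poly_expansion yP.
have Ja := little_oh_poly0 aP; have Jb := little_oh_poly0 bP.
have ay0 := expansion_le (rE _ _ (fE _ aP)) (rE _ _ yE) (slt_sle ay).
have yb0 := expansion_le (rE _ _ yE) (rE _ _ (fE _ bP)) (slt_sle yb).
have ab0 : a 0 <= b 0.
  rewrite leNgt; apply/negP => /(fmono _ _ Jb Ja); rewrite ltNge.
  by rewrite (le_trans ay0 yb0).
have [c0 c0ab fc0] : exists2 c0, c0 \in `[a 0, b 0] & f c0 = y 0.
  apply: IVT => //.
    apply: derivable_within_continuous => z; rewrite in_itv => zab.
    by apply: (fU 0%N); apply: JU; exact: iJ zab.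
  rewrite ge_min le_max; case: (sqr1_cases rho2) ay0 yb0 => ->.
    by rewrite !mul1r => -> ->; rewrite !orbT.
  by rewrite !mulN1r !lerN2 => -> ->; rewrite !orbT.
have Jc0 : J c0 by move: c0ab; rewrite in_itv; exact: iJ.
have Uc0 := JU _ Jc0.
have yE' : expansion y (f c0) by rewrite fc0.
(* The position of the root between the endpoints is automatic: strict monotonicity carries the
   eventual inequalities between values back to arguments. *)
suff [c [cP cy]] : exists c, little_oh_poly J c /\ small_oh (fun t => f (c t) - y t).
  have rcy : small_oh (fun t => rho * y t - rho * f (c t)).
    have := small_ohM (bounded_at0_cst rho) (small_ohN cy).
    by apply: small_oh_ext => t; ring.
  exists c; split => //.
    apply: near_lt_sle aE (little_oh_poly_expansion cP) _.
    have /slt_lt H := slt_small_oh (small_oh_refl _) rcy ay.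
    near=> t; apply: fle; [near: t; exact: nearJ|near: t; exact: nearJ|by near: t].
  apply: near_lt_sle (little_oh_poly_expansion cP) bE _.
  have /slt_lt H := slt_small_oh rcy (small_oh_refl _) yb.
  near=> t; apply: fle; [near: t; exact: nearJ|near: t; exact: nearJ|by near: t].
have [m' m'0 fm'] := order_at_ex (nf _ Uc0).
case: m' m'0 fm' => // m _ fm.
(* A root on the side [sg] of [c0]; the point [p] of [J] on that side guarantees that [J] contains
   room for it. *)
have side sg p : sg ^+ 2 = 1 -> J p -> 0 < sg * (p - c0) ->
    slt (fun=> 0) (fun t => sg * rho * (y t - f c0)) ->
    exists c, little_oh_poly J c /\ small_oh (fun t => f (c t) - y t).
  move=> sg2 Jp pc0 ysg.
  have sgK : sg * sg = 1 by rewrite -expr2.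
  have Jside s : 0 < sg * (s - c0) -> sg * (s - c0) <= sg * (p - c0) -> J s.
    case: (sqr1_cases sg2) => ->; rewrite ?mul1r ?mulN1r ?lerN2 ?oppr_gt0.
      by rewrite subr_gt0 lerD2r => /ltW cs sp; apply: iJ Jc0 Jp _ _; rewrite cs.
    by rewrite subr_lt0 lerD2r => /ltW cs sp; apply: iJ Jp Jc0 _ _; rewrite cs sp.
  have sr2 : (sg * rho) ^+ 2 = 1 by rewrite exprMn sg2 rho2 mul1r.
  have [|c [cE c00 csg cy]] := one_sided_root oU fU Uc0 fm sg2 sr2 yE' ysg.
    (* The test point at distance [h] on the side [sg] lies closer to [c0] than [d] and no further
       than [p]. *)
    move=> d d0; pose h := Num.min (d / 2) (sg * (p - c0)).
    have h0 : 0 < h by rewrite lt_min pc0 divr_gt0.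
    have hE : sg * (c0 + sg * h - c0) = h by rewrite addrAC subrr add0r mulrA sgK mul1r.
    have Js : J (c0 + sg * h).
      by apply: Jside; rewrite hE// ge_min lexx orbT.
    exists (c0 + sg * h); split; rewrite ?hE//.
      have -> : c0 + sg * h - c0 = sg * h by rewrite addrAC subrr add0r.
      rewrite normrM; have -> : `|sg| = 1.
        by case: (sqr1_cases sg2) => ->; rewrite ?normrN normr1.
      rewrite mul1r gtr0_norm//; apply: (@le_lt_trans _ _ (d / 2)).
        by rewrite ge_min lexx.
      by rewrite ltr_pdivrMr// ltr_pMr// ltr1n.
    rewrite -mulrA mulrBr; case: (sqr1_cases sg2) hE Js => -> hE Js.
      rewrite mul1r subr_gt0; apply: fmono => //.
      by rewrite mul1r ltrDl.
    rewrite mulN1r opprB subr_gt0; apply: fmono => //.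
    by rewrite mulN1r gtrDl oppr_lt0.
  exists c; split => //; apply: near_little_oh_poly; rewrite ?c00//.
  have /cvgr_dist_lt/(_ _ pc0) H := expansion_cvg cE.
  near=> t; apply: Jside; first by near: t.
  have : `|c0 - c t| < sg * (p - c0) by near: t.
  move=> /ltW; apply: le_trans; apply: le_trans (ler_norm _) _.
  rewrite normrM; have -> : `|sg| = 1.
    by case: (sqr1_cases sg2) => ->; rewrite ?normrN normr1.
  by rewrite mul1r distrC.
have cstE : expansion (fun=> f c0) (f c0) by exact: expansion_cst.
(* If [rho * y] is below [rho * f c0], some value of [a] lies left of [c0]; if above, some value of
   [b] lies right of it. If they agree up to o(t), the constant [c0] is a root. *)
have [yc|cy|yc] := slt_trichotomy (rE _ _ yE') (rE _ _ cstE).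
- have [t [Jt act]] : exists t, J (a t) /\ a t < c0.
    have /slt_lt H := slt_trans ay yc; have aJ := nearJ _ aP.
    apply: near0_ex; near=> t.
    have Jt : J (a t) by near: t.
    by split => //; apply: fle => //; near: t.
  apply: (side (-1) (a t)) => //; first by rewrite sqrrN expr1n.
    by rewrite mulN1r oppr_gt0 subr_lt0.
  by apply: slt_near yc; apply: nearW => u; ring.
- have [t [Jt act]] : exists t, J (b t) /\ c0 < b t.
    have /slt_lt H := slt_trans cy yb; have bJ := nearJ _ bP.
    apply: near0_ex; near=> t.
    have Jt : J (b t) by near: t.
    by split => //; apply: fle => //; near: t.
  apply: (side 1 (b t)) => //; first by rewrite expr1n.
    by rewrite mul1r subr_gt0.
  by apply: slt_near cy; apply: nearW => u; ring.
exists (fun=> c0); split.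
  by apply: near_little_oh_poly => //; [exact: nearW|exact: expansion_cst].
have := small_ohM (bounded_at0_cst (- rho)) yc.
apply: small_oh_ext => t.
have -> : - rho * (rho * y t - rho * f c0) = (rho * rho) * (f c0 - y t) by ring.
by rewrite rhoK mul1r.
Unshelve. all: by end_near. Qed.

End MonotonePieces.

(** * From monotone pieces to arbitrary intervals *)

Section IntermediateValue.
Context {R : realType} (U : set R) (f : R -> R).
Context (oU : open U) (fU : smooth_on U f).
Implicit Types (J : set R) (a b c x y : R -> R).

(** The property for a single interval, stated for representatives, so that intervals can be cut and
    endpoints moved by o(t). *)
Definition ivp_between a b : Prop := forall y, little_oh_poly setT y ->
  (sle (f \o a) y /\ sle y (f \o b)) \/ (sle (f \o b) y /\ sle y (f \o a)) ->
  exists c, [/\ little_oh_poly U c, sle a c, sle c b &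
    small_oh (fun t => f (c t) - y t)].

Lemma comp_expansion x : little_oh_poly U x -> expansion (f \o x) (f (x 0)).
Proof. by move=> /(little_oh_poly_comp oU fU)/little_oh_poly_expansion. Qed.

Lemma comp_small_oh x y : little_oh_poly U x -> little_oh_poly U y ->
  small_oh (fun t => x t - y t) -> small_oh (fun t => f (x t) - f (y t)).
Proof. by move=> xP yP /(lo_equivE xP yP)/(lo_equiv_comp oU fU xP yP)[]. Qed.

Lemma little_oh_polyS J x : J `<=` U -> little_oh_poly J x -> little_oh_poly U x.
Proof.
by move=> JU [[e e0 xJ] xE]; split => //; exists e => // t /xJ/JU.
Qed.

Lemma little_oh_poly_cst J (u : R) : J u -> little_oh_poly J (fun=> u).
Proof.
move=> Ju; apply: near_little_oh_poly => //; first exact: nearW.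
exact: expansion_cst.
Qed.

Lemma sle_refl x : sle x x. Proof. by right; exact: small_oh_refl. Qed.

Lemma slt_sle_false x y : slt x y -> sle y x -> False.
Proof.
move=> xy [/(slt_asym xy)//|yx].
have h := slt_small_oh (small_oh_refl x) yx xy.
exact: (slt_asym h h).
Qed.

Lemma ivp_between_small_oh a a' b b' :
  little_oh_poly U a -> little_oh_poly U a' ->
  little_oh_poly U b -> little_oh_poly U b' ->
  small_oh (fun t => a t - a' t) -> small_oh (fun t => b t - b' t) ->
  ivp_between a b -> ivp_between a' b'.
Proof.
move=> aP a'P bP b'P aa' bb' ab y yP yab.
have faa' := small_oh_sym (comp_small_oh aP a'P aa').
have fbb' := small_oh_sym (comp_small_oh bP b'P bb').
have [|c [cP ac cb cy]] := ab y yP.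
  case: yab => -[h1 h2]; [left|right]; split.
  - exact: sle_small_oh faa' (small_oh_refl _) h1.
  - exact: sle_small_oh (small_oh_refl _) fbb' h2.
  - exact: sle_small_oh fbb' (small_oh_refl _) h1.
  - exact: sle_small_oh (small_oh_refl _) faa' h2.
exists c; split => //.
  exact: sle_small_oh aa' (small_oh_refl _) ac.
exact: sle_small_oh (small_oh_refl _) bb' cb.
Qed.

(** By totality [y] is comparable with [f b], so it lies between the values at the ends of one of
    the two subintervals. *)
Lemma ivp_between_trans b a c : little_oh_poly U b -> sle a b -> sle b c ->
  ivp_between a b -> ivp_between b c -> ivp_between a c.
Proof.
move=> bP ab bc iab ibc y yP yac.
have yE := little_oh_poly_expansion yP.
have left_case : (sle (f \o a) y /\ sle y (f \o b)) \/
    (sle (f \o b) y /\ sle y (f \o a)) -> exists c0, [/\ little_oh_poly U c0,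
    sle a c0, sle c0 c & small_oh (fun t => f (c0 t) - y t)].
  move=> /(iab y yP)[d [dP ad db dy]]; exists d; split => //.
  exact: sle_trans bc.
have right_case : (sle (f \o b) y /\ sle y (f \o c)) \/
    (sle (f \o c) y /\ sle y (f \o b)) -> exists c0, [/\ little_oh_poly U c0,
    sle a c0, sle c0 c & small_oh (fun t => f (c0 t) - y t)].
  move=> /(ibc y yP)[d [dP bd dc dy]]; exists d; split => //.
  exact: sle_trans bd.
case: yac (sle_total yE (comp_expansion bP)) => -[h1 h2] [yb|byy].
- by apply: left_case; left.
- by apply: right_case; left.
- by apply: right_case; right.
- by apply: left_case; right.
Qed.

Context (nonflat : forall u, U u ->
  exists m, (0 < m)%N /\ (f^`(m))%classic u != 0).

Lemma monotone_ivp J (rho : R) a b : J `<=` U -> is_interval J -> rho ^+ 2 = 1 ->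
  (forall s s', J s -> J s' -> s < s' -> rho * f s < rho * f s') ->
  little_oh_poly J a -> little_oh_poly J b -> sle a b -> ivp_between a b.
Proof.
move=> JU iJ rho2 fmono aP bP ab y yP yab.
have yE := little_oh_poly_expansion yP.
have aU := little_oh_polyS JU aP; have bU := little_oh_polyS JU bP.
have rE x d : expansion x d -> expansion (fun t => rho * x t) (rho * d).
  by move=> /(expansionM (expansion_cst rho)).
have rhoK : rho * rho = 1 by rewrite -expr2.
have unscale x x' : small_oh (fun t => rho * x t - rho * x' t) ->
    small_oh (fun t => x t - x' t).
  move=> /(small_ohM (bounded_at0_cst rho)); apply: small_oh_ext => t.
  have -> : rho * (rho * x t - rho * x' t) = rho * rho * (x t - x' t) by ring.
  by rewrite rhoK mul1r.
have atA : small_oh (fun t => f (a t) - y t) -> exists c, [/\ little_oh_poly U c,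
    sle a c, sle c b & small_oh (fun t => f (c t) - y t)].
  by exists a; split => //; exact: sle_refl.
have atB : small_oh (fun t => f (b t) - y t) -> exists c, [/\ little_oh_poly U c,
    sle a c, sle c b & small_oh (fun t => f (c t) - y t)].
  by exists b; split => //; exact: sle_refl.
(* [y] cannot be strictly beyond both endpoint values on the same side; [s] is [rho] or [- rho]
   according to the side. *)
have outside s : s ^+ 2 = 1 -> slt (fun t => s * f (a t)) (fun t => s * y t) ->
    slt (fun t => s * f (b t)) (fun t => s * y t) -> False.
  case/sqr1_cases => -> ay yfb.
    have lt1 x x' : slt (fun t => 1 * x t) (fun t => 1 * x' t) -> slt x x'.
      by apply: slt_near; apply: nearW => t; ring.
    by case: yab => -[_]; apply: slt_sle_false; exact: lt1.
  have ltN1 x x' : slt (fun t => -1 * x t) (fun t => -1 * x' t) -> slt x' x.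
    by apply: slt_near; apply: nearW => t; ring.
  by case: yab => -[+ _]; apply: slt_sle_false; exact: ltN1.
have [ay|ya|/unscale/atA//] := slt_trichotomy (rE _ _ (comp_expansion aU)) (rE _ _ yE);
have [yfb|yb|/unscale/atB//] := slt_trichotomy (rE _ _ (comp_expansion bU)) (rE _ _ yE).
- by case: (outside rho).
- have [c [cP ac cb cy]] := monotone_root oU fU nonflat JU iJ rho2 fmono aP bP yP ay yb.
  by exists c; split => //; exact: little_oh_polyS cP.
- have [c [cP bc ca cy]] := monotone_root oU fU nonflat JU iJ rho2 fmono bP aP yP yfb ya.
  exists c; split => //; first exact: little_oh_polyS cP.
    exact: sle_trans ab bc.
  exact: sle_trans ca ab.
- have neg x x' : slt (fun t => rho * x t) (fun t => rho * x' t) ->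
      slt (fun t => - rho * x' t) (fun t => - rho * x t).
    by apply: slt_near; apply: nearW => t; ring.
  by case: (outside (- rho)); rewrite ?sqrrN//; exact: neg.
Qed.

(** The derivative is controlled only strictly between points of [J], so an endpoint of [J] may be a
    critical point. *)
Lemma derive_sign_homo J (rho : R) : J `<=` U -> is_interval J ->
  (forall s s' z, J s -> J s' -> s < z < s' -> 0 < rho * (f^`())%classic z) ->
  forall s s', J s -> J s' -> s < s' -> rho * f s < rho * f s'.
Proof.
move=> JU iJ df s s' Js Js' ss'.
have fder z : z \in `[s, s'] -> derivable f z 1.
  by rewrite in_itv => szs; apply: (@fU 0%N); apply: JU; exact: iJ szs.
have [||c cs fE] := @MVT R f (f^`())%classic s s' ss'.
- move=> z /subset_itv_oo_cc /fder zd; rewrite derive1E; exact: derivableP.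
- exact: derivable_within_continuous.
rewrite -subr_gt0 -mulrBr fE mulrA mulr_gt0 ?subr_gt0//.
by apply: (df s s') => //; move: cs; rewrite in_itv.
Qed.

Lemma local_ivp u : U u -> exists2 d : R, 0 < d & forall a b,
  little_oh_poly U a -> little_oh_poly U b -> sle a b ->
  u - d < a 0 -> b 0 < u + d -> ivp_between a b.
Proof.
move=> Uu; have [m' m'0 fm'] := order_at_ex (nonflat Uu).
case: m' m'0 fm' => // m _ fm.
have [d d0 H] := order_at_derive_sign oU fU Uu fm.
case: fm => _; set D := (f^`(m.+1))%classic u in H * => D0.
have [rho rho2 rhoD] : exists2 rho, rho ^+ 2 = 1 & 0 < rho * D.
  exists (Num.sg D); first by rewrite sqr_sg D0.
  by rewrite -normrEsg normr_gt0.
pose JR := [set s | u <= s < u + d]; pose JL := [set s | u - d < s <= u].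
have JRU : JR `<=` U.
  move=> s /andP[us sd]; have [->//|su] := eqVneq s u.
  by case: (H s) => //; rewrite ger0_norm; lra.
have JLU : JL `<=` U.
  move=> s /andP[ds su]; have [->//|su'] := eqVneq s u.
  by case: (H s) => //; rewrite ler0_norm; lra.
have iJR : is_interval JR.
  move=> x y /andP[ux _] /andP[_ yd] z /andP[xz zy].
  by apply/andP; split; [exact: le_trans xz|exact: le_lt_trans yd].
have iJL : is_interval JL.
  move=> x y /andP[dx _] /andP[_ yu] z /andP[xz zy].
  by apply/andP; split; [exact: lt_le_trans xz|exact: le_trans yu].
have monoR : forall s s', JR s -> JR s' -> s < s' -> rho * f s < rho * f s'.
  apply: derive_sign_homo => // s s' z /andP[us _] /andP[_ s'd] /andP[sz zs'].
  have zu : 0 < z - u by lra.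
  have [||_] := H z; [rewrite gtr0_norm//; lra|by rewrite -subr_eq0 gt_eqF|].
  move: (f^`() z)%classic => F Fz.
  have := mulr_gt0 Fz rhoD.
  have -> : F * (z - u) ^+ m * D * (rho * D) = (z - u) ^+ m * D ^+ 2 * (rho * F) by ring.
  rewrite pmulr_rgt0// mulr_gt0//; first exact: exprn_gt0.
  by rewrite exprn_even_gt0.
(* Left of [u] the factor [(z - u) ^ m] has sign [(-1) ^ m], which enters the direction of
   monotonicity. *)
have monoL : forall s s', JL s -> JL s' -> s < s' ->
    (-1) ^+ m * rho * f s < (-1) ^+ m * rho * f s'.
  apply: derive_sign_homo => // s s' z /andP[ds _] /andP[_ s'u] /andP[sz zs'].
  have zu : z - u < 0 by lra.
  have [||_] := H z; [rewrite ltr0_norm//; lra|by rewrite -subr_eq0 lt_eqF|].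
  move: (f^`() z)%classic => F Fz.
  have uz : 0 < (-1 * (z - u)) ^+ m by rewrite exprn_gt0// mulN1r oppr_gt0.
  have := mulr_gt0 (mulr_gt0 Fz rhoD) uz.
  rewrite exprMn; move: ((z - u) ^+ m) uz Fz => h uz Fz.
  have -> : F * h * D * (rho * D) * ((-1) ^+ m * h) =
    (h * D) ^+ 2 * ((-1) ^+ m * rho * F) by ring.
  rewrite pmulr_rgt0// exprn_even_gt0// mulf_neq0//.
  by apply: contraTneq Fz => ->; rewrite mulr0 mul0r ltxx.
have rhoL2 : ((-1) ^+ m * rho) ^+ 2 = 1 by rewrite exprMn rho2 mulr1 sqrr_sign.
have cstE : expansion (fun=> u) u by exact: expansion_cst.
(* A representative with [u <= x] only up to o(t) may take values left of [u]; if it agrees with [u]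
   up to o(t), it is replaced by the constant [u], and otherwise it already lies in [JR]
   eventually. *)
have uR x : little_oh_poly U x -> sle (fun=> u) x -> x 0 < u + d ->
    exists2 x', little_oh_poly JR x' & small_oh (fun t => x' t - x t).
  move=> xP ux xd; have xE := little_oh_poly_expansion xP.
  have ux0 := expansion_le cstE xE ux.
  case: ux => [/slt_lt ux|ux]; last first.
    by exists (fun=> u) => //; apply: little_oh_poly_cst; rewrite /JR /= lexx ltrDl.
  exists x; last exact: small_oh_refl.
  have xd0 : 0 < u + d - x 0 by rewrite subr_gt0.
  have /cvgr_dist_lt/(_ _ xd0) xcvg := expansion_cvg xE.
  apply: near_little_oh_poly => //; first by rewrite /JR /= ux0.
  near=> t; apply/andP; split; first by apply: ltW; near: t.
  have : `|x 0 - x t| < u + d - x 0 by near: t.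
  by rewrite ltr_norml => /andP[? _]; lra.
have uL x : little_oh_poly U x -> sle x (fun=> u) -> u - d < x 0 ->
    exists2 x', little_oh_poly JL x' & small_oh (fun t => x' t - x t).
  move=> xP xu xd; have xE := little_oh_poly_expansion xP.
  have xu0 := expansion_le xE cstE xu.
  case: xu => [/slt_lt xu|/small_oh_sym xu]; last first.
    exists (fun=> u) => //; apply: little_oh_poly_cst.
    by rewrite /JL /= lexx andbT gtrDl oppr_lt0.
  exists x; last exact: small_oh_refl.
  have xd0 : 0 < x 0 - (u - d) by rewrite subr_gt0.
  have /cvgr_dist_lt/(_ _ xd0) xcvg := expansion_cvg xE.
  apply: near_little_oh_poly => //; first by rewrite /JL /= xd.
  near=> t; apply/andP; split; last by apply: ltW; near: t.
  have : `|x 0 - x t| < x 0 - (u - d) by near: t.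
  by rewrite ltr_norml => /andP[_ ?]; lra.
have right_ivp a b : little_oh_poly U a -> little_oh_poly U b -> sle (fun=> u) a ->
    sle a b -> b 0 < u + d -> ivp_between a b.
  move=> aP bP ua ab bd.
  have ab0 := expansion_le (little_oh_poly_expansion aP) (little_oh_poly_expansion bP) ab.
  have [a' a'P aa'] := uR a aP ua (le_lt_trans ab0 bd).
  have [b' b'P bb'] := uR b bP (sle_trans ua ab) bd.
  apply: (ivp_between_small_oh _ aP _ bP aa' bb'); try exact: little_oh_polyS JRU _.
  apply: (monotone_ivp JRU iJR rho2 monoR) => //.
  exact: sle_small_oh (small_oh_sym aa') (small_oh_sym bb') ab.
have left_ivp a b : little_oh_poly U a -> little_oh_poly U b -> sle b (fun=> u) ->
    sle a b -> u - d < a 0 -> ivp_between a b.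
  move=> aP bP bu ab da.
  have ab0 := expansion_le (little_oh_poly_expansion aP) (little_oh_poly_expansion bP) ab.
  have [a' a'P aa'] := uL a aP (sle_trans ab bu) da.
  have [b' b'P bb'] := uL b bP bu (lt_le_trans da ab0).
  apply: (ivp_between_small_oh _ aP _ bP aa' bb'); try exact: little_oh_polyS JLU _.
  apply: (monotone_ivp JLU iJL rhoL2 monoL) => //.
  exact: sle_small_oh (small_oh_sym aa') (small_oh_sym bb') ab.
exists d => // a b aP bP ab da bd.
have aE := little_oh_poly_expansion aP; have bE := little_oh_poly_expansion bP.
have [ua|au] := sle_total cstE aE; first exact: right_ivp.
have [ub|bu] := sle_total cstE bE; last exact: left_ivp.
have uP := little_oh_poly_cst Uu.
apply: (ivp_between_trans uP) => //.
  by apply: left_ivp => //; exact: sle_refl.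
by apply: right_ivp => //; exact: sle_refl.
Unshelve. all: by end_near. Qed.

Lemma lt_expansion_sle x y (c d : R) : expansion x c -> expansion y d -> c < d -> sle x y.
Proof.
move=> xc yd cd; have [//|yx] := sle_total xc yd.
by have := expansion_le yd xc yx; rewrite leNgt cd.
Qed.

Lemma global_ivp a b : is_interval U -> little_oh_poly U a -> little_oh_poly U b ->
  sle a b -> ivp_between a b.
Proof.
move=> iU aP bP ab.
have aE := little_oh_poly_expansion aP; have bE := little_oh_poly_expansion bP.
have ab0 := expansion_le aE bE ab.
have Ua := little_oh_poly0 aP; have Ub := little_oh_poly0 bP.
(* [s] belongs to [S] when every right endpoint with standard part at most [s] is admissible,
   whatever its infinitesimal part. *)
pose S := [set s | a 0 <= s <= b 0 /\ forall b', little_oh_poly U b' ->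
  sle a b' -> b' 0 <= s -> ivp_between a b'].
have Sa : S (a 0).
  split; first by rewrite lexx.
  move=> b' b'P ab' b'a; have [d d0 H] := local_ivp Ua.
  by apply: H => //; [rewrite gtrDl oppr_lt0|apply: (le_lt_trans b'a); rewrite ltrDl].
have Ssup : has_sup S.
  by split; [exists (a 0)|exists (b 0) => s [/andP[]]].
have aS : a 0 <= sup S by exact: ub_le_sup Ssup.2 _ Sa.
have Sb : sup S <= b 0 by apply: ge_sup; [exists (a 0)|move=> s [/andP[]]].
have US : U (sup S) by apply: iU Ua Ub _ _; rewrite aS.
have [d d0 H] := local_ivp US.
have [s [/andP[as_ sb] Ss] ds] := sup_adherent d0 Ssup.
(* The property extends past the supremum by [d]: unless [S] or the local result covers [[a, b']]
   directly, the interval is cut at the real point [s], which lies in the local neighbourhood. *)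
have claim b' : little_oh_poly U b' -> sle a b' -> b' 0 < sup S + d -> ivp_between a b'.
  move=> b'P ab' b'd; have [|sb'] := leP (b' 0) s; first exact: Ss.
  have [da|ad] := ltP (sup S - d) (a 0); first exact: H.
  have as' : a 0 < s by exact: le_lt_trans ds.
  have sP : little_oh_poly U (fun=> s).
    by apply: little_oh_poly_cst; apply: iU Ua Ub _ _; rewrite as_.
  have sE := expansion_cst s.
  apply: (ivp_between_trans sP).
  - exact: lt_expansion_sle aE sE as'.
  - exact: lt_expansion_sle sE (little_oh_poly_expansion b'P) sb'.
  - by apply: Ss => //; exact: lt_expansion_sle aE sE as'.
  - by apply: H => //; exact: lt_expansion_sle sE (little_oh_poly_expansion b'P) sb'.
have [bS|Sdb] := ltP (b 0) (sup S + d); first exact: claim.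
(* If [b] were out of reach of the claim, [S] would contain a point beyond its supremum. *)
have : S (sup S + d / 2).
  split; first by apply/andP; split; lra.
  by move=> b' b'P ab' b'S; apply: claim => //; lra.
by move=> /(ub_le_sup Ssup.2); lra.
Qed.

End IntermediateValue.

Theorem corollary38 (R : realType) (U : set R) (f : R -> R)
  (oU : open U) (cU : connected U) (fU : smooth_on U f)
  (no_flat_point : forall u : R, U u ->
    exists m : nat, (0 < m)%N /\ (f^`(m))%classic u != 0) :
  intermediate_value_property (fext oU fU).
Proof.
(* With all classes written through representatives, [fleP] and [fclassP] translate order and
   equality into [sle] and agreement up to o(t). *)
move=> a b; rewrite -[a]freprK -[b]freprK !fincl_class => -[/fleP ab _] y.
rewrite -[y]freprK !fext_class => yab.
have [|c [cP ac cb cy]] := global_ivp oU fU no_flat_point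
    ((connected_intervalP U).1 cU) (lopolyP (frepr a)) (lopolyP (frepr b)) ab
    (lopolyP (frepr y)).
  by case: yab => -[/fleP h1 /fleP h2]; [left|right].
exists (fclass (Lopoly cP)).
rewrite !fincl_class fext_class; split; [exact/fleP|exact/fleP|].
exact/fclassP/(lo_equivE (little_oh_poly_comp oU fU cP) (lopolyP (frepr y))).
Qed.
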